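(* Let $\mathcal{A}$ be a finite-dimensional operator algebra. Then, for every $s\in\mathbb{C}\langle\mathcal{A},\mathcal{A}^*\rangle$ there is a finite-dimensional Hilbert space $\mathfrak{F}$ and a $*$-homomorphism $\pi:C^*_{\max}(\mathcal{A})\to B(\mathfrak{F})$ with the property that $\|\pi(s)\|=\|s\|$. In particular, the algebra $C^*_{\max}(\mathcal{A})$ is RFD.
   Context: An operator algebra is a norm closed subalgebra of $B(\mathfrak{H})$, $\mathfrak{H}$ a complex Hilbert space (not necessarily unital or self-adjoint). A $C^*$-algebra is residually finite-dimensional (RFD) if it admits an injective $*$-homomorphism into a product $\prod_\lambda\mathbb{M}_{r_\lambda}$ of matrix algebras (bounded families, supremum norm). The maximal $C^*$-cover of $\mathcal{A}$ is the essentially unique pair $(C^*_{\max}(\mathcal{A}),\mu)$ where $C^*_{\max}(\mathcal{A})$ is a $C^*$-algebra and $\mu:\mathcal{A}\to C^*_{\max}(\mathcal{A})$ is a completely isometric homomorphism with $C^*(\mu(\mathcal{A}))=C^*_{\max}(\mathcal{A})$, such that for every completely contractive homomorphism $\phi:\mathcal{A}\to B(\mathfrak{H}_\phi)$ there is a $*$-homomorphism $\pi_\phi:C^*_{\max}(\mathcal{A})\to B(\mathfrak{H}_\phi)$ with $\pi_\phi\circ\mu=\phi$. The subset $\mathbb{C}\langle\mathcal{A},\mathcal{A}^*\rangle\subset C^*_{\max}(\mathcal{A})$ is the linear span of words in the elements of $\mu(\mathcal{A})\cup\mu(\mathcal{A})^*$. *)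

(* Defs.v *)
From HB Require Import structures.
From mathcomp Require Import all_boot all_order all_algebra.
From mathcomp Require Import sesquilinear spectral.
From mathcomp Require Import complex.
From mathcomp Require Import boolp classical_sets functions reals topology
  normedtype.

Set Implicit Arguments.
Unset Strict Implicit.
Unset Printing Implicit Defensive.

Import Order.TTheory GRing.Theory Num.Theory Num.Def.
Import numFieldNormedType.Exports.

Local Open Scope classical_set_scope.
Local Open Scope ring_scope.
Local Open Scope complex_scope.
Local Open Scope sesquilinear_scope.

(* The forms {dot H for conjC} are linear in the first argument. *)
HB.mixin Record isHilbert (R : realType) H
    & CompleteNormedModule R[i] H := {
  hdot : {dot H for @conjC R[i]} ;
  hdot_norm : forall x : H, `|x| ^+ 2 = hdot x x
}.

#[short(type="hilbertType")]
HB.structure Definition Hilbert (R : realType) :=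
  {H of CompleteNormedModule R[i] H & isHilbert R H}.

Definition findim (K : nzRingType) (V : lmodType K) (A : set V) : Prop :=
  exists n (b : 'I_n -> V), (forall i, A (b i)) /\
    forall x, A x -> exists c : 'I_n -> K, x = \sum_(i < n) c i *: b i.

(* The norm of a normed module over R[i] takes its values in R[i]; they are
   nonnegative reals, read back in R. *)
Definition hnorm (R : realType) (H : hilbertType R) (x : H) : R :=
  complex.Re `|x|.

(* B(H), as a set of functions.  Operators are added and scaled pointwise, and
   their product is the composition. *)
Definition bounded_op (R : realType) (H : hilbertType R) : set (H -> H) :=
  [set T | linear T /\ exists M : R, forall x, hnorm (T x) <= M * hnorm x].

Definition opnorm (R : realType) (H : hilbertType R) (T : H -> H) : R :=
  sup [set hnorm (T x) | x in [set x | hnorm x <= 1]].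

(* M_n(B(H)) acts on the Hilbert space sum of n copies of H. *)
Definition mxopnorm (R : realType) (H : hilbertType R) n
    (T : 'M[H -> H]_n) : R :=
  sup [set Num.sqrt (\sum_(i < n) hnorm (\sum_(j < n) T i j (x j)) ^+ 2)
      | x in [set x : 'I_n -> H | \sum_(j < n) hnorm (x j) ^+ 2 <= 1]].

(* On bounded operators, adjoint T S says that S is the Hilbert space adjoint
   of T. *)
Definition adjoint (R : realType) (H : hilbertType R) (T S : H -> H) : Prop :=
  forall x y : H, hdot (T x) y = hdot x (S y).

Record operator_algebra (R : realType) (H : hilbertType R)
    (A : set (H -> H)) : Prop := {
  opalg_bounded : A `<=` bounded_op (H := H) ;
  opalg0 : A 0 ;
  opalgD : forall T S, A T -> A S -> A (T + S) ;
  opalgZ : forall (c : R[i]) T, A T -> A (c *: T) ;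
  opalgM : forall T S, A T -> A S -> A (T \o S) ;
  opalg_closed : forall T, bounded_op T ->
    (forall e : R, 0 < e -> exists2 S, A S & opnorm (T - S) < e) -> A T
}.

Definition cstar_algebra (R : realType) (H : hilbertType R)
    (C : set (H -> H)) : Prop :=
  operator_algebra C /\ forall T, C T -> exists2 S, C S & adjoint T S.

(* Maps defined on an algebra are total functions of which only the values on
   that algebra matter. *)
Record alg_hom (R : realType) (H K : hilbertType R) (A : set (H -> H))
    (phi : (H -> H) -> (K -> K)) : Prop := {
  alg_hom_bounded : forall T, A T -> bounded_op (phi T) ;
  alg_homD : forall T S, A T -> A S -> phi (T + S) = phi T + phi S ;
  alg_homZ : forall (c : R[i]) T, A T -> phi (c *: T) = c *: phi T ;
  alg_homM : forall T S, A T -> A S -> phi (T \o S) = phi T \o phi S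
}.

Definition star_hom (R : realType) (H K : hilbertType R) (C : set (H -> H))
    (pi : (H -> H) -> (K -> K)) : Prop :=
  alg_hom C pi /\
  forall T S, C T -> C S -> adjoint T S -> adjoint (pi T) (pi S).

Definition completely_contractive (R : realType) (H K : hilbertType R)
    (A : set (H -> H)) (phi : (H -> H) -> (K -> K)) : Prop :=
  forall n (T : 'M[H -> H]_n), (forall i j, A (T i j)) ->
    mxopnorm (map_mx phi T) <= mxopnorm T.

Definition completely_isometric (R : realType) (H K : hilbertType R)
    (A : set (H -> H)) (phi : (H -> H) -> (K -> K)) : Prop :=
  forall n (T : 'M[H -> H]_n), (forall i j, A (T i j)) ->
    mxopnorm (map_mx phi T) = mxopnorm T.

Record max_cstar_cover (R : realType) (H K : hilbertType R)
    (A : set (H -> H)) (C : set (K -> K))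
    (mu : (H -> H) -> (K -> K)) : Prop := {
  max_cover_cstar : cstar_algebra C ;
  max_cover_hom : alg_hom A mu ;
  max_cover_isometric : completely_isometric A mu ;
  max_cover_generated : smallest (@cstar_algebra R K) (mu @` A) = C ;
  max_cover_universal : forall (L : hilbertType R)
    (phi : (H -> H) -> (L -> L)),
    alg_hom A phi -> completely_contractive A phi ->
    exists2 pi : (K -> K) -> (L -> L), star_hom C pi &
      forall T, A T -> pi (mu T) = phi T
}.

Definition adjoints (R : realType) (H : hilbertType R) (E : set (H -> H)) :
    set (H -> H) :=
  [set S | exists2 T, E T & adjoint T S].

Inductive word (X : Type) (E : set (X -> X)) : (X -> X) -> Prop :=
| word_letter T : E T -> word E T
| word_mul T W : E T -> word E W -> word E (T \o W).

Definition lin_span (K : nzRingType) (V : lmodType K) (E : set V) : set V :=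
  [set x | exists n (c : 'I_n -> K) (w : 'I_n -> V),
    (forall i, E (w i)) /\ x = \sum_(i < n) c i *: w i].

(* The set C<A, A^*> of noncommutative *-polynomials; as there is no empty
   word, it does not contain the identity operator in general. *)
Definition star_polynomials (R : realType) (H K : hilbertType R)
    (A : set (H -> H)) (mu : (H -> H) -> (K -> K)) : set (K -> K) :=
  lin_span (word (mu @` A `|` adjoints (mu @` A)) : set (K -> K)).

Definition l2norm (R : realType) n (v : 'cV[R[i]]_n) : R :=
  Num.sqrt (\sum_(i < n) complex.Re `|v i 0| ^+ 2).

(* The norm of M as an operator on the Hilbert space C^n; the norm that
   matrices carry in the library is the largest modulus of an entry. *)
Definition l2opnorm (R : realType) n (M : 'M[R[i]]_n) : R :=
  sup [set l2norm (M *m v) | v in [set v | l2norm v <= 1]].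

Record mx_star_hom (R : realType) (H : hilbertType R) (C : set (H -> H)) n
    (pi : (H -> H) -> 'M[R[i]]_n) : Prop := {
  mx_star_homD : forall T S, C T -> C S -> pi (T + S) = pi T + pi S ;
  mx_star_homZ : forall (c : R[i]) T, C T -> pi (c *: T) = c *: pi T ;
  mx_star_homM : forall T S, C T -> C S -> pi (T \o S) = pi T *m pi S ;
  mx_star_homV : forall T S, C T -> C S -> adjoint T S -> pi S = (pi T) ^t*
}.

(* A *-homomorphism into a product of matrix algebras is given by its
   components; its values have to be bounded families. *)
Definition RFD (R : realType) (H : hilbertType R) (C : set (H -> H)) : Prop :=
  exists (I : Type) (r : I -> nat) (pi : forall i, (H -> H) -> 'M[R[i]]_(r i)),
    [/\ forall i, (0 < r i)%N,
        forall i, mx_star_hom C (pi i),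
        forall T, C T -> has_ubound (range (fun i => l2opnorm (pi i T))) &
        forall T S, C T -> C S -> (forall i, pi i T = pi i S) -> T = S].

(* Main.v *)
(* Let xi_n be vectors of the unit ball of K with |s xi_n| -> |s|.  Applying to
   xi_n the suffixes of the words of s, and then mu(A), spans a mu(A)-invariant
   subspace F_n whose dimension is bounded independently of n because A is
   finite-dimensional; hence compression to F_n is a completely contractive
   homomorphism of A, and compressing each letter a or a^* of s changes nothing
   on the vectors met while computing s xi_n.  Identifying F_n with a subspace
   of a fixed C^N, compactness gives an ultralimit phi of these compressions,
   and the *-homomorphism pi extending phi satisfies |pi(s) eta| = |s| for eta
   the limit of the vectors xi_n.  The reverse inequality is contractivity of
   *-homomorphisms.  Since *-polynomials are dense in C*_max(A), the maps pi
   separate its points, whence RFD. *)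

Require Import Defs.
From HB Require Import structures.
From mathcomp Require Import all_boot all_order all_algebra.
From mathcomp Require Import sesquilinear complex.
From mathcomp Require Import boolp classical_sets functions reals topology
  normedtype realfun sequences.
From mathcomp Require Import ring lra.

Set Implicit Arguments.
Unset Strict Implicit.
Unset Printing Implicit Defensive.

Import Order.TTheory GRing.Theory Num.Theory Num.Def.
Import numFieldNormedType.Exports.

Local Open Scope classical_set_scope.
Local Open Scope ring_scope.
Local Open Scope complex_scope.

(** * The complex modulus and the Hilbert space C^n *)

(** The norm of s need not be attained in K, and the xi_n may have no convergent subsequence there;
    moving the F_n into one C^N is what makes compactness available. The dimension bound comes from
    A being closed under products: applying mu(A) twice yields nothing beyond applying it once, so a
    spanning family of A applied to the suffix vectors is enough. In general F_n is not invariant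
    under the letters a^*, so compression is not multiplicative on all *-polynomials. The vector
    pi(s) eta is found by following each word letter by letter. Contractivity is not part of
    [star_hom], and C may lack a unit; this leads to a Neumann series without its constant term. *)

Section Modulus.
Variable R : realType.
Implicit Types z w : R[i].

Lemma real_complexE z : 0 <= z -> z = (complex.Re z)%:C.
Proof. by case: z => a b; rewrite lecE /= => /andP[/eqP->]. Qed.

Definition modulus z : R := complex.Re `|z|.

Lemma modulusE z : `|z| = (modulus z)%:C.
Proof. exact: real_complexE. Qed.

Lemma modulus_ge0 z : 0 <= modulus z.
Proof. by rewrite -ler0c -modulusE. Qed.

Lemma modulusM z w : modulus (z * w) = modulus z * modulus w.
Proof. by apply: (@complexI R); rewrite rmorphM -!modulusE normrM. Qed.

Lemma modulus_real (r : R) : modulus r%:C = `|r|.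
Proof. by rewrite /modulus normc_def /= expr0n addr0 sqrtr_sqr. Qed.

Lemma ler_norm_Re_modulus z : `|complex.Re z| <= modulus z.
Proof.
case: z => a b; rewrite /modulus normc_def /= -sqrtr_sqr ler_wsqrtr //.
by rewrite lerDl sqr_ge0.
Qed.

Lemma ler_norm_Im_modulus z : `|complex.Im z| <= modulus z.
Proof.
case: z => a b; rewrite /modulus normc_def /= -sqrtr_sqr ler_wsqrtr //.
by rewrite lerDr sqr_ge0.
Qed.

Lemma ler_modulus_Re z : complex.Re z <= modulus z.
Proof.
exact: le_trans (ler_norm _) (ler_norm_Re_modulus _).
Qed.

Lemma conjC_real_complex (r : R) : conjC (r%:C : R[i]) = r%:C.
Proof. by apply/CrealP; rewrite complex_real. Qed.

Lemma mul_conjC_modulus z : z * conjC z = (modulus z ^+ 2)%:C.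
Proof. by rewrite -normCK modulusE rmorphXn. Qed.

End Modulus.

(** Norms here take values in R[i]; this moves convergence to the ordered field R, where squeezing
    and comparison of limits are available. *)
Lemma cvg_Re_normP (R : realType) (V : normedModType R[i]) (T : Type)
    (F : set_system T) {FF : Filter F} (f : T -> V) (l : V) :
  f @ F --> l <-> complex.Re `|l - f t| @[t --> F] --> (0 : R).
Proof.
split=> [/cvgrPdist_lt h|/cvgrPdist_lt h].
  apply/cvgrPdist_lt => e e0; have := h e%:C; rewrite ltcR => /(_ e0).
  apply: filterS => t; rewrite sub0r normrN -ltcR => /le_lt_trans; apply.
  by rewrite ger0_norm -?real_complexE // -ler0c -real_complexE.
apply/cvgrPdist_lt => e e0; have e0' := real_complexE (ltW e0).
move: e0; rewrite e0' ltcR => /h.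
apply: filterS => t; rewrite sub0r normrN -ltcR; apply: le_lt_trans.
rewrite ger0_norm -?real_complexE // -ler0c -real_complexE //.
Qed.

Definition ell2 (R : realType) (n : nat) : Type := 'cV[R[i]]_n.

Section Ell2.
Variables (R : realType) (n : nat).
Notation C := R[i].

HB.instance Definition _ := GRing.Lmodule.copy (ell2 R n) 'cV[C]_n.

Definition ell2_dot (u v : 'cV[C]_n) : C := \sum_i u i 0 * conjC (v i 0).

Let ell2_dot_bilinear : bilinear_for
  (GRing.Scale.Law.clone _ _ ( *%R ) _)
  (GRing.Scale.Law.clone _ _ (conjC \; *%R ) _) ell2_dot.
Proof.
split=> [v|v] a x y /=; rewrite /ell2_dot mulr_sumr -big_split /=;
  apply: eq_bigr => i _; rewrite !mxE ?rmorphD ?rmorphM /=; ring.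
Qed.

HB.instance Definition _ := bilinear_isBilinear.Build C 'cV[C]_n 'cV[C]_n C
   _ _ ell2_dot ell2_dot_bilinear.

Let ell2_dot_herm (x y : 'cV[C]_n) :
  ell2_dot x y = (-1) ^+ false * conjC (ell2_dot y x).
Proof.
rewrite mul1r /ell2_dot rmorph_sum; apply: eq_bigr => i _.
by rewrite rmorphM /= conjCK mulrC.
Qed.

HB.instance Definition _ :=
  isHermitianSesquilinear.Build C 'cV[C]_n false conjC ell2_dot ell2_dot_herm.

Lemma ell2_dotE (x : 'cV[C]_n) : ell2_dot x x = (l2norm x ^+ 2)%:C.
Proof.
rewrite sqr_sqrtr; last by apply: sumr_ge0 => i _; exact: sqr_ge0.
by rewrite rmorph_sum; apply: eq_bigr => i _; rewrite mul_conjC_modulus.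
Qed.

Lemma l2norm_eq0 (x : 'cV[C]_n) : l2norm x = 0 -> x = 0.
Proof.
move=> /eqP; rewrite sqrtr_eq0 => h.
have h0 : \sum_i modulus (x i 0) ^+ 2 == 0.
  by rewrite eq_le h sumr_ge0 // => i _; exact: sqr_ge0.
move: h0; rewrite psumr_eq0 => [/allP h0|i _]; last exact: sqr_ge0.
apply/colP => i; rewrite mxE; apply/eqP; rewrite -normr_eq0 modulusE.
by have := h0 i (mem_index_enum i); rewrite /= expf_eq0 /= => /eqP->.
Qed.

Let ell2_dot_pos (x : 'cV[C]_n) : x != 0 -> 0 < ell2_dot x x.
Proof.
move=> x0; rewrite ell2_dotE ltcR exprn_gt0 // lt_neqAle sqrtr_ge0 andbT.
by apply: contraNneq x0 => h; rewrite (@l2norm_eq0 x).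
Qed.

HB.instance Definition _ := isDotProduct.Build C 'cV[C]_n ell2_dot ell2_dot_pos.

Definition ell2_norm (x : ell2 R n) : C := (l2norm x)%:C.

Lemma l2norm_sqrtC (x : 'cV[C]_n) : (l2norm x)%:C = sqrtC (ell2_dot x x).
Proof. by rewrite ell2_dotE rmorphXn sqrCK // ler0c sqrtr_ge0. Qed.

Let ell2_normD (x y : ell2 R n) : ell2_norm (x + y) <= ell2_norm x + ell2_norm y.
Proof. by rewrite /ell2_norm !l2norm_sqrtC triangle_lerif. Qed.

Let ell2_normZ (l : C) (x : ell2 R n) : ell2_norm (l *: x) = `|l| * ell2_norm x.
Proof.
apply/eqP; rewrite -(@eqrXn2 _ 2) ?ler0c ?sqrtr_ge0 //; last first.
  by rewrite mulr_ge0 // ler0c sqrtr_ge0.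
have E (y : ell2 R n) : ell2_norm y ^+ 2 = ell2_dot y y.
  by rewrite ell2_dotE rmorphXn.
by rewrite exprMn !E dnormZ.
Qed.

Let ell2_norm0_eq0 (x : ell2 R n) : ell2_norm x = 0 -> x = 0.
Proof. by move=> /(@complexI R) /l2norm_eq0. Qed.

HB.instance Definition _ := Lmodule_isNormed.Build C (ell2 R n)
  ell2_normD ell2_normZ ell2_norm0_eq0.

Lemma ler_modulus_l2norm (x : 'cV[C]_n) i : modulus (x i 0) <= l2norm x.
Proof.
rewrite -(ger0_norm (modulus_ge0 _)) -sqrtr_sqr ler_wsqrtr //.
by rewrite (bigD1 i) //= lerDl sumr_ge0 // => j _; exact: sqr_ge0.
Qed.

Lemma ler_l2norm_Re (x : 'cV[C]_n) i : `|complex.Re (x i 0)| <= l2norm x.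
Proof. exact: le_trans (ler_norm_Re_modulus _) (ler_modulus_l2norm _ _). Qed.

Lemma ler_l2norm_Im (x : 'cV[C]_n) i : `|complex.Im (x i 0)| <= l2norm x.
Proof. exact: le_trans (ler_norm_Im_modulus _) (ler_modulus_l2norm _ _). Qed.

(** Splitting into real and imaginary parts reduces completeness and compactness of C^n to those
    facts about R. *)
Lemma ell2_cvg_coord (T : Type) (F : set_system T) (f : T -> ell2 R n)
    (l : ell2 R n) : Filter F ->
  (forall i, complex.Re (f t i 0) @[t --> F] --> complex.Re (l i 0)) ->
  (forall i, complex.Im (f t i 0) @[t --> F] --> complex.Im (l i 0)) ->
  f @ F --> l.
Proof.
move=> FF hRe hIm; apply/cvg_Re_normP => /=.
have -> : (0 : R) = Num.sqrt (\sum_(i < n)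
  ((complex.Re (l i 0) - complex.Re (l i 0)) ^+ 2 +
   (complex.Im (l i 0) - complex.Im (l i 0)) ^+ 2)).
  by rewrite big1 ?sqrtr0 // => i _; rewrite !subrr expr0n addr0.
have -> : (fun t => complex.Re `|l - f t|) =
  (fun t => Num.sqrt (\sum_(i < n)
  ((complex.Re (l i 0) - complex.Re (f t i 0)) ^+ 2 +
   (complex.Im (l i 0) - complex.Im (f t i 0)) ^+ 2))).
  apply/funext => t; congr Num.sqrt; apply: eq_bigr => i _.
  rewrite !mxE; case: (l i 0) (f t i 0) => [a b] [c d].
  by rewrite normc_def /= sqr_sqrtr // addr_ge0 // sqr_ge0.
apply: continuous_cvg; first exact: sqrt_continuous.
apply: cvg_big => [|i _]; first exact: add_continuous.
by apply: cvgD; rewrite !expr2; apply: cvgM; apply: cvgB (cvg_cst _) _.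
Qed.

Lemma ell2_hdot_norm (x : ell2 R n) : `|x| ^+ 2 = ell2_dot x x.
Proof. by rewrite ell2_dotE rmorphXn. Qed.

Let ell2_complete (F : set_system (ell2 R n)) :
  ProperFilter F -> cauchy F -> cvg F.
Proof.
move=> FF Fc.
(* A 1-Lipschitz real function maps a Cauchy filter to a Cauchy filter of R; it is applied to the
   real and imaginary parts of the coordinates. *)
have coord (p : ell2 R n -> R) : (forall x y, `|p x - p y| <= l2norm (x - y)) ->
    exists l : R, p @ F --> l.
  move=> hp; apply/cvg_ex.
  apply: cauchy_cvg; apply: cauchy_exP => e e0.
  have /cauchyP /(_ e%:C) := Fc; rewrite ltcR => /(_ e0)[x Fx].
  exists (p x); rewrite -ball_normE /=; apply: filterS Fx => y.
  rewrite -ball_normE /= => h; apply: le_lt_trans (hp x y) _.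
  by rewrite -ltcR.
have hRe i : exists l : R, complex.Re (x i 0) @[x --> F] --> l.
  apply: coord => x y; have <- : complex.Re ((x - y) i 0) =
      complex.Re (x i 0) - complex.Re (y i 0).
    by rewrite !mxE; case: (x i 0) (y i 0) => [? ?] [].
  exact: ler_l2norm_Re.
have hIm i : exists l : R, complex.Im (x i 0) @[x --> F] --> l.
  apply: coord => x y; have <- : complex.Im ((x - y) i 0) =
      complex.Im (x i 0) - complex.Im (y i 0).
    by rewrite !mxE; case: (x i 0) (y i 0) => [? ?] [].
  exact: ler_l2norm_Im.
have [a ha] := choice hRe; have [b hb] := choice hIm.
pose l : ell2 R n := \col_i (a i +i* b i).
apply/cvg_ex; exists l; apply: (@ell2_cvg_coord _ _ id) => i; rewrite mxE.
- exact: ha.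
- exact: hb.
Qed.

HB.instance Definition _ := Uniform_isComplete.Build (ell2 R n) ell2_complete.

HB.instance Definition _ := @isHilbert.Build R (ell2 R n)
  (ell2_dot : {dot (ell2 R n) for @conjC C}) ell2_hdot_norm.

End Ell2.

(** * Hilbert space and operator basics *)

Section HilbertBasics.
Variables (R : realType) (H : hilbertType R).
Implicit Types (x y z : H) (c : R[i]).

Lemma hnormE x : `|x| = (hnorm x)%:C.
Proof. exact: real_complexE. Qed.

Lemma hnorm_ge0 x : 0 <= hnorm x.
Proof. by rewrite -ler0c -hnormE. Qed.

Lemma hnorm0 : hnorm (0 : H) = 0.
Proof. by rewrite /hnorm normr0. Qed.

Lemma hnorm_eq0 x : hnorm x = 0 -> x = 0.
Proof. by move=> h; apply/eqP; rewrite -normr_eq0 hnormE h. Qed.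

Lemma hnormN x : hnorm (- x) = hnorm x.
Proof. by rewrite /hnorm normrN. Qed.

Lemma ler_hnormD x y : hnorm (x + y) <= hnorm x + hnorm y.
Proof. by rewrite -lecR rmorphD /= -!hnormE ler_normD. Qed.

Lemma ler_hnormB x y : hnorm (x - y) <= hnorm x + hnorm y.
Proof. by rewrite -(hnormN y) ler_hnormD. Qed.

Lemma hnormZ c x : hnorm (c *: x) = modulus c * hnorm x.
Proof.
by apply: (@complexI R); rewrite rmorphM /= -!hnormE -modulusE normrZ.
Qed.

Lemma ler_hnorm_sum n (f : 'I_n -> H) :
  hnorm (\sum_i f i) <= \sum_i hnorm (f i).
Proof.
elim/big_ind2: _ => [|a b c d ab cd|//]; first by rewrite hnorm0.
exact: le_trans (ler_hnormD _ _) (lerD ab cd).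
Qed.

Lemma hdotxx x : hdot x x = (hnorm x ^+ 2)%:C.
Proof. by rewrite -hdot_norm hnormE rmorphXn. Qed.

Lemma hdotC x y : hdot x y = conjC (hdot y x).
Proof. by rewrite (hermC (hdot : {dot H for @conjC R[i]})) expr0 mul1r. Qed.

Lemma hdotDl x y z : hdot (x + y) z = hdot x z + hdot y z.
Proof. exact: linearDl. Qed.
Lemma hdotDr x y z : hdot z (x + y) = hdot z x + hdot z y.
Proof. exact: linearDr. Qed.
Lemma hdotBl x y z : hdot (x - y) z = hdot x z - hdot y z.
Proof. exact: linearBl. Qed.
Lemma hdotBr x y z : hdot z (x - y) = hdot z x - hdot z y.
Proof. exact: linearBr. Qed.
Lemma hdotZl c x y : hdot (c *: x) y = c * hdot x y.
Proof. exact: linearZl_LR. Qed.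
Lemma hdotZr c x y : hdot x (c *: y) = conjC c * hdot x y.
Proof. exact: linearZr_LR. Qed.
Lemma hdot0l x : hdot 0 x = 0.
Proof. exact: linear0l. Qed.
Lemma hdot0r x : hdot x 0 = 0.
Proof. exact: linear0r. Qed.
Lemma hdot_suml n (f : 'I_n -> H) y : hdot (\sum_i f i) y = \sum_i hdot (f i) y.
Proof. exact: linear_sumlz. Qed.
Lemma hdot_sumr n (f : 'I_n -> H) y : hdot y (\sum_i f i) = \sum_i hdot y (f i).
Proof. exact: linear_sumr. Qed.

Lemma hdot_inj x y : (forall z, hdot z x = hdot z y) -> x = y.
Proof.
move=> h; have : hdot (x - y) (x - y) = 0 by rewrite hdotBr h subrr.
rewrite hdotxx => /(@complexI R) /eqP; rewrite expf_eq0 /= => /eqP.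
by move=> /hnorm_eq0 /eqP; rewrite subr_eq0 => /eqP.
Qed.

Lemma hnorm_sqrB x y :
  hnorm (x - y) ^+ 2 = hnorm x ^+ 2 + hnorm y ^+ 2 - 2 * complex.Re (hdot x y).
Proof.
apply: (@complexI R); rewrite -hdotxx hdotBl !hdotBr !hdotxx (hdotC y x).
case: (hdot x y) => a b; rewrite -[conjC _]/(a -i* b).
by apply/eqP; rewrite eq_complex /=; apply/andP; split; apply/eqP; ring.
Qed.

Lemma hdot_cauchy_schwarz x y : modulus (hdot x y) <= hnorm x * hnorm y.
Proof.
have [->|y0] := eqVneq y 0.
  by rewrite hdot0r hnorm0 mulr0 modulus_real normr0.
have ny : 0 < hnorm y.
  rewrite lt_neqAle hnorm_ge0 andbT; apply: contraNneq y0 => h.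
  by rewrite (@hnorm_eq0 y).
rewrite -ler_sqr ?nnegrE ?modulus_ge0 ?mulr_ge0 ?hnorm_ge0 // exprMn.
(* [t *: y] is the orthogonal projection of [x] onto the line of [y]; the inequality is the
   nonnegativity of |x - t y|^2. *)
pose t := hdot x y / (hnorm y ^+ 2)%:C.
have := sqr_ge0 (hnorm (x - t *: y)); rewrite hnorm_sqrB hdotZr hnormZ.
have -> : conjC t * hdot x y = (modulus (hdot x y) ^+ 2 / hnorm y ^+ 2)%:C.
  rewrite /t rmorphM /= fmorphV /= conjC_real_complex mulrAC (mulrC (conjC _)).
  by rewrite mul_conjC_modulus -fmorphV -rmorphM.
have -> : modulus t = modulus (hdot x y) / hnorm y ^+ 2.
  by rewrite /t modulusM -fmorphV modulus_real ger0_norm // invr_ge0 sqr_ge0.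
rewrite /=; set a := modulus _; set b := hnorm y; set d := hnorm x => h.
have b0 : b != 0 by rewrite gt_eqF.
have : 0 <= (d ^+ 2 - a ^+ 2 / b ^+ 2) * b ^+ 2.
  rewrite mulr_ge0 ?sqr_ge0 //; apply: le_trans h _.
  rewrite le_eqVlt; apply/orP; left; apply/eqP; field.
  exact: b0.
by rewrite mulrBl divfK ?expf_neq0 // subr_ge0.
Qed.

End HilbertBasics.

Section Linear.
Variables (K : nzRingType) (U V : lmodType K) (T : U -> V).
Hypothesis Tlin : linear T.

Lemma linear_fun0 : T 0 = 0.
Proof. by have := Tlin (-1) 0 0; rewrite scaler0 addr0 scaleN1r addNr. Qed.
Lemma linear_funD x y : T (x + y) = T x + T y.
Proof. by have := Tlin 1 x y; rewrite !scale1r. Qed.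
Lemma linear_funZ c x : T (c *: x) = c *: T x.
Proof. by have := Tlin c x 0; rewrite linear_fun0 !addr0. Qed.
Lemma linear_funB x y : T (x - y) = T x - T y.
Proof. by rewrite linear_funD -scaleN1r linear_funZ scaleN1r. Qed.
Lemma linear_fun_sum n (f : 'I_n -> U) : T (\sum_i f i) = \sum_i T (f i).
Proof.
by elim/big_rec2: _ => [|i x y _ <-]; rewrite ?linear_fun0 ?linear_funD.
Qed.

End Linear.

Section Operators.
Variables (R : realType) (H : hilbertType R).
Implicit Types (T S : H -> H) (x y : H).

Lemma opnorm_le T (M : R) : 0 <= M ->
  (forall x, hnorm (T x) <= M * hnorm x) -> opnorm T <= M.
Proof.
move=> M0 hM; apply: ge_sup; first by exists (hnorm (T 0)), 0; rewrite //= hnorm0.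
move=> _ [x /= x1 <-]; apply: le_trans (hM x) _.
by rewrite ler_piMr.
Qed.

Lemma opnorm_has_sup T : bounded_op T ->
  has_sup [set hnorm (T x) | x in [set x | hnorm x <= 1]].
Proof.
move=> [_ [M hM]]; split; first by exists (hnorm (T 0)), 0; rewrite //= hnorm0.
exists `|M| => _ [x /= x1 <-]; apply: le_trans (hM x) _.
apply: le_trans (_ : `|M| * hnorm x <= _); last by rewrite ler_piMr.
by rewrite ler_wpM2r ?hnorm_ge0 // ler_norm.
Qed.

Lemma opnorm_ge0 T : bounded_op T -> 0 <= opnorm T.
Proof.
move=> /opnorm_has_sup[_ Tub]; apply: le_trans (hnorm_ge0 (T 0)) _.
by apply: ub_le_sup => //; exists 0; rewrite //= hnorm0.
Qed.

Lemma ler_opnorm T x : bounded_op T -> hnorm (T x) <= opnorm T * hnorm x.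
Proof.
move=> bT; have [Tlin _] := bT; have [_ Tub] := opnorm_has_sup bT.
have [->|x0] := eqVneq x 0.
  by rewrite (linear_fun0 Tlin) hnorm0 mulr0.
have nx : 0 < hnorm x.
  rewrite lt_neqAle hnorm_ge0 andbT; apply: contraNneq x0 => h.
  by rewrite (@hnorm_eq0 _ _ x).
have mx : modulus ((hnorm x)^-1)%:C = (hnorm x)^-1.
  by rewrite modulus_real ger0_norm // invr_ge0 ltW.
rewrite -ler_pdivrMr // mulrC -mx -hnormZ -linear_funZ //.
apply: ub_le_sup => //; exists (((hnorm x)^-1)%:C *: x) => //=.
by rewrite hnormZ mx mulVf // gt_eqF.
Qed.

Lemma opnorm_approx T (e : R) : bounded_op T -> 0 < e ->
  exists2 x, hnorm x <= 1 & opnorm T - e < hnorm (T x).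
Proof.
move=> bT e0; have [_ [x /= x1 <-] h] := sup_adherent e0 (opnorm_has_sup bT).
by exists x.
Qed.

Lemma bounded_op_linear T : bounded_op T -> linear T.
Proof. by case. Qed.

Lemma bounded_opP T (M : R) : linear T ->
  (forall x, hnorm (T x) <= M * hnorm x) -> bounded_op T.
Proof. by move=> Tlin hM; split=> //; exists M. Qed.

Lemma bounded_opD T S : bounded_op T -> bounded_op S -> bounded_op (T + S).
Proof.
move=> bT bS; apply: (@bounded_opP _ (opnorm T + opnorm S)) => [c x y|x].
  rewrite /= !fctE (bounded_op_linear bT) (bounded_op_linear bS).
  by rewrite scalerDr !addrA (addrAC _ (T y)).
by apply: le_trans (ler_hnormD _ _) _; rewrite mulrDl lerD // ler_opnorm.
Qed.

Lemma bounded_opZ (c : R[i]) T : bounded_op T -> bounded_op (c *: T).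
Proof.
move=> bT; apply: (@bounded_opP _ (modulus c * opnorm T)) => [a x y|x].
  rewrite /= !fctE (bounded_op_linear bT).
  by rewrite scalerDr !scalerA (mulrC c).
by rewrite hnormZ -mulrA ler_wpM2l ?modulus_ge0 // ler_opnorm.
Qed.

Lemma bounded_opB T S : bounded_op T -> bounded_op S -> bounded_op (T - S).
Proof. by move=> bT bS; rewrite -scaleN1r; apply/bounded_opD/bounded_opZ. Qed.

Lemma bounded_opM T S : bounded_op T -> bounded_op S -> bounded_op (T \o S).
Proof.
move=> bT bS; apply: (@bounded_opP _ (opnorm T * opnorm S)) => [a x y|x] /=.
  by rewrite (bounded_op_linear bS) (bounded_op_linear bT).
apply: le_trans (ler_opnorm _ bT) _; rewrite -mulrA.
by rewrite ler_wpM2l ?opnorm_ge0 // ler_opnorm.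
Qed.

Lemma opnorm0_eq0 T : bounded_op T -> opnorm T = 0 -> T = 0.
Proof.
move=> bT T0; apply/funext => x; apply: hnorm_eq0; apply/eqP.
by rewrite eq_le hnorm_ge0 andbT -(mul0r (hnorm x)) -T0 ler_opnorm.
Qed.

Lemma opnormD T S : bounded_op T -> bounded_op S ->
  opnorm (T + S) <= opnorm T + opnorm S.
Proof.
move=> bT bS; apply: opnorm_le => [|x]; first by rewrite addr_ge0 ?opnorm_ge0.
by apply: le_trans (ler_hnormD _ _) _; rewrite mulrDl lerD // ler_opnorm.
Qed.

Lemma opnormZ_le (c : R[i]) T : bounded_op T ->
  opnorm (c *: T) <= modulus c * opnorm T.
Proof.
move=> bT; apply: opnorm_le => [|x]; first by rewrite mulr_ge0 ?opnorm_ge0 ?modulus_ge0.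
by rewrite hnormZ -mulrA ler_wpM2l ?modulus_ge0 // ler_opnorm.
Qed.

Lemma opnormM T S : bounded_op T -> bounded_op S ->
  opnorm (T \o S) <= opnorm T * opnorm S.
Proof.
move=> bT bS; apply: opnorm_le => [|x /=]; first by rewrite mulr_ge0 ?opnorm_ge0.
apply: le_trans (ler_opnorm _ bT) _; rewrite -mulrA.
by rewrite ler_wpM2l ?opnorm_ge0 // ler_opnorm.
Qed.

Lemma adjoint_sym T S : adjoint T S -> adjoint S T.
Proof. by move=> TS x y; rewrite hdotC -TS -hdotC. Qed.

Lemma adjoint_unique T S S' : adjoint T S -> adjoint T S' -> S = S'.
Proof.
by move=> TS TS'; apply/funext => y; apply: hdot_inj => z; rewrite -TS TS'.
Qed.

Lemma adjoint_linear T S : adjoint T S -> linear S.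
Proof.
move=> TS c x y; apply: hdot_inj => z.
by rewrite -TS !hdotDr !hdotZr !TS.
Qed.

(** |S y|^2 = <T S y, y> is at most |T| |S y| |y|; divide by |S y|. Boundedness of an adjoint is
    thus a consequence of that of [T]. *)
Lemma adjoint_le T S y : bounded_op T -> adjoint T S ->
  hnorm (S y) <= opnorm T * hnorm y.
Proof.
move=> bT TS; have [h0|n0] := eqVneq (hnorm (S y)) 0.
  by rewrite h0 mulr_ge0 ?opnorm_ge0 ?hnorm_ge0.
have Sy : 0 < hnorm (S y) by rewrite lt_neqAle eq_sym n0 hnorm_ge0.
rewrite -(ler_pM2r Sy) -expr2; have := hdot_cauchy_schwarz (T (S y)) y.
rewrite TS hdotxx modulus_real ger0_norm ?sqr_ge0 // => /le_trans; apply.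
by rewrite mulrAC ler_wpM2r ?hnorm_ge0 // ler_opnorm.
Qed.

Lemma adjoint_bounded T S : bounded_op T -> adjoint T S -> bounded_op S.
Proof.
move=> bT TS; apply: (@bounded_opP _ (opnorm T)); first exact: adjoint_linear TS.
by move=> y; exact: adjoint_le.
Qed.

Lemma adjoint_opnorm T S : bounded_op T -> adjoint T S -> opnorm S <= opnorm T.
Proof.
move=> bT TS; apply: opnorm_le; first exact: opnorm_ge0.
by move=> y; exact: adjoint_le.
Qed.

Lemma adjointB T T' S S' : adjoint T S -> adjoint T' S' ->
  adjoint (T - T') (S - S').
Proof. by move=> TS TS' x y; rewrite hdotBl hdotBr TS TS'. Qed.

Lemma adjointM T T' S S' : adjoint T S -> adjoint T' S' ->
  adjoint (T \o T') (S' \o S).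
Proof. by move=> TS TS' x y; rewrite /= TS TS'. Qed.

End Operators.

(** * *-homomorphisms are contractive *)

Section Neumann.
Variables (R : realType) (H : hilbertType R) (C : set (H -> H)).
Hypothesis Calg : operator_algebra C.
Variable P : H -> H.
Hypotheses (CP : C P) (P1 : opnorm P < 1).

Let bP : bounded_op P. Proof. exact: (opalg_bounded Calg). Qed.
Let Plin : linear P. Proof. exact: bounded_op_linear bP. Qed.
Let P0 : 0 <= opnorm P. Proof. exact: opnorm_ge0. Qed.

(** The partial sums P + ... + P^n start at [P] and not at the identity, so that they stay in an
    algebra that may have no unit. *)
Fixpoint neumann_sum n : H -> H :=
  if n is n'.+1 then P + (P \o neumann_sum n') else 0.

Let neumann_sum_in n : C (neumann_sum n).
Proof.
elim: n => [|n IHn] /=; first exact: opalg0 Calg.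
by apply: (opalgD Calg) => //; exact: (opalgM Calg).
Qed.

Let neumann_sum_le n x :
  hnorm (neumann_sum n x) <= (1 - opnorm P)^-1 * hnorm x.
Proof.
have d0 : 0 < 1 - opnorm P by rewrite subr_gt0.
elim: n => [|n IHn] /=.
  by rewrite hnorm0 mulr_ge0 ?hnorm_ge0 // invr_ge0 ltW.
apply: le_trans (ler_hnormD _ _) _; rewrite /comp.
have := ler_opnorm x bP; have := ler_opnorm (neumann_sum n x) bP.
have h : opnorm P * hnorm (neumann_sum n x) <=
   opnorm P * ((1 - opnorm P)^-1 * hnorm x) by exact: ler_wpM2l.
(* The constant B = (1 - |P|)^-1 solves B = 1 + |P| B, hence reproduces itself under the
   recursion. *)
have -> : (1 - opnorm P)^-1 * hnorm x =
   hnorm x + opnorm P * ((1 - opnorm P)^-1 * hnorm x).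
  field; exact: lt0r_neq0.
have := hnorm_ge0 x.
have : opnorm P * hnorm x <= hnorm x by rewrite ler_piMl ?hnorm_ge0 // ltW.
lra.
Qed.

Let iter_le n x : hnorm (iter n P x) <= opnorm P ^+ n * hnorm x.
Proof.
elim: n => [|n IHn]; first by rewrite expr0 mul1r.
rewrite iterS exprS -mulrA; apply: le_trans (ler_opnorm _ bP) _.
exact: ler_wpM2l.
Qed.

Let neumann_sumB n x k :
  neumann_sum (n + k) x - neumann_sum n x = iter n P (neumann_sum k x).
Proof.
elim: n => [|n IHn]; first by rewrite subr0.
rewrite iterS -IHn (linear_funB Plin) addSn /= !fctE.
by rewrite opprD addrACA subrr add0r.
Qed.

Let geometric_small (B e : R) : 0 <= B -> 0 < e ->
  exists n, opnorm P ^+ n * B < e.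
Proof.
move=> B0 e0; have : GRing.exp (opnorm P) @ \oo --> (0 : R).
  by apply: cvg_expr; rewrite ger0_norm.
have e1 : 0 < e / (B + 1) by rewrite divr_gt0 // ltr_wpDl.
move=> /cvgrPdist_lt /(_ _ e1)[n _ /(_ n (leqnn _))] /=.
rewrite sub0r normrN ger0_norm ?exprn_ge0 // ltr_pdivlMr ?ltr_wpDl // => h.
exists n; apply: le_lt_trans h.
by rewrite ler_wpM2l ?exprn_ge0 // lerDl.
Qed.

Let neumann_sum_cvg x : exists y : H, neumann_sum n x @[n --> \oo] --> y.
Proof.
apply/cvg_ex; apply: cauchy_cvg; apply: cauchy_exP => e e0.
have [d0 eE] : 0 < complex.Re e /\ e = (complex.Re e)%:C.
  by split; [rewrite -ltcR -real_complexE // ltW|apply/real_complexE/ltW].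
have B0 : 0 <= (1 - opnorm P)^-1 * hnorm x.
  by rewrite mulr_ge0 ?hnorm_ge0 // invr_ge0 subr_ge0 ltW.
have [n hn] := geometric_small B0 d0.
exists (neumann_sum n x); exists n => // m /= nm.
rewrite -ball_normE /= distrC hnormE eE ltcR -(subnKC nm) neumann_sumB.
apply: le_lt_trans (iter_le _ _) (le_lt_trans _ hn).
by rewrite ler_wpM2l ?exprn_ge0.
Qed.

(** The difference satisfies y - z = P (y - z) with |P| < 1. This uniqueness gives linearity of the
    limit [Q] and P Q = Q P without further limits. *)
Let fixpoint_unique x y z : y = P x + P y -> z = P x + P z -> y = z.
Proof.
move=> Ey Ez; apply/eqP; rewrite -subr_eq0; apply/eqP/hnorm_eq0/eqP.
have E : y - z = P (y - z).
  by rewrite {1}Ey {1}Ez opprD addrACA subrr add0r -linear_funB.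
have := ler_opnorm (y - z) bP; rewrite -E; have := hnorm_ge0 (y - z).
rewrite eq_le => h0; rewrite h0 andbT -subr_le0 -{1}[hnorm _]mul1r -mulrBl.
by rewrite pmulr_rle0 // subr_gt0.
Qed.

(* [Q] is the sum of the Neumann series [P + P^2 + P^3 + ...]. *)
Lemma neumann_series : exists2 Q, C Q & Q = P + (Q \o P).
Proof.
have [Q hQ] := choice neumann_sum_cvg.
have Qfix x : Q x = P x + P (Q x).
  apply/eqP; rewrite -subr_eq0; apply/eqP/hnorm_eq0/eqP.
  rewrite eq_le hnorm_ge0 andbT; apply/ler_addgt0Pl => e e0; rewrite addr0.
  have e1 : 0 < (e / 2)%:C :> R[i] by rewrite ltcR divr_gt0.
  have /cvgrPdist_lt/(_ _ e1)[n _ hn] := hQ x.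
  have := hn n (leqnn _); have := hn n.+1 (leqnSn _) => /=.
  rewrite !hnormE !ltcR !fctE => h1 h2.
  have -> : Q x - (P x + P (Q x)) =
     (Q x - (P x + P (neumann_sum n x))) - P (Q x - neumann_sum n x).
    rewrite (linear_funB Plin) !opprD opprK !addrA.
    by rewrite [RHS]addrAC subrK.
  apply: le_trans (ler_hnormB _ _) _.
  have := ler_opnorm (Q x - neumann_sum n x) bP.
  have : opnorm P * hnorm (Q x - neumann_sum n x) <= hnorm (Q x - neumann_sum n x).
    by rewrite ler_piMl ?hnorm_ge0 // ltW.
  move: h1 h2; rewrite /=; lra.
have Qlin : linear Q.
  move=> c x y; apply: (@fixpoint_unique (c *: x + y)) => //.
  rewrite [in LHS]Qfix [in LHS](Qfix y) !Plin scalerDr !addrA; congr (_ + _).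
  by rewrite -!addrA; congr (_ + _); rewrite addrC.
have Qle x : hnorm (Q x) <= (1 - opnorm P)^-1 * hnorm x.
  have d0 : 0 < 1 - opnorm P by rewrite subr_gt0.
  rewrite mulrC ler_pdivlMr // mulrBr mulr1 lerBlDr {1}Qfix.
  apply: le_trans (ler_hnormD _ _) _.
  have := ler_opnorm x bP; have := ler_opnorm (Q x) bP.
  have : opnorm P * hnorm x <= hnorm x by rewrite ler_piMl ?hnorm_ge0 // ltW.
  rewrite (mulrC (hnorm (Q x))) /=; lra.
have bQ : bounded_op Q by exact: bounded_opP Qle.
(* The tail of the series is P^n Q, of operator norm at most |P|^n (1 - |P|)^-1: convergence is in
   operator norm, so closedness of [C] puts [Q] in [C]. *)
have QB n x : Q x - neumann_sum n x = iter n P (Q x).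
  elim: n => [|n IHn]; first by rewrite subr0.
  rewrite iterS -IHn (linear_funB Plin) {1}Qfix /= !fctE.
  by rewrite opprD addrACA subrr add0r.
exists Q.
  apply: (opalg_closed Calg bQ) => e e0.
  have d0 : 0 <= (1 - opnorm P)^-1 by rewrite invr_ge0 subr_ge0 ltW.
  have [n hn] := geometric_small d0 e0.
  exists (neumann_sum n) => //; apply: le_lt_trans hn.
  apply: opnorm_le => [|x]; first by rewrite mulr_ge0 ?exprn_ge0.
  rewrite !fctE QB -mulrA; apply: le_trans (iter_le _ _) _.
  by rewrite ler_wpM2l ?exprn_ge0.
apply/funext => x; rewrite !fctE /= {1}Qfix; congr (_ + _).
apply: (@fixpoint_unique (P x)) => //.
by rewrite {1}Qfix linear_funD.
Qed.

End Neumann.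

(* If |pi T| = a > |T|, then P = a^-2 T^* T has norm < 1 and its Neumann series
   Q lies in C and satisfies Q = P + Q P.  Vectors v at which pi T nearly
   attains its norm are almost fixed by pi P, whereas
   pi P v = pi Q (v - pi P v). *)
Lemma star_hom_contractive (R : realType) (H L : hilbertType R)
    (C : set (H -> H)) (pi : (H -> H) -> (L -> L)) (T : H -> H) :
  cstar_algebra C -> star_hom C pi -> C T -> opnorm (pi T) <= opnorm T.
Proof.
move=> [Calg Cstar] [pihom pistar] CT; rewrite leNgt; apply/negP => lt_Ta.
have [S CS TS] := Cstar T CT.
have bT : bounded_op T by exact: (opalg_bounded Calg).
have bS : bounded_op S by exact: (opalg_bounded Calg).
have bpi U : C U -> bounded_op (pi U) by exact: (alg_hom_bounded pihom).
have q0 := opnorm_ge0 bT.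
have Sq := adjoint_opnorm bT TS.
have piTS := pistar _ _ CT CS TS.
move: lt_Ta; set q := opnorm T in q0 Sq *; set a := opnorm (pi T) => lt_qa.
have a0 : 0 < a by exact: le_lt_trans lt_qa.
pose r := a ^+ 2; have r0 : 0 < r by rewrite exprn_gt0.
have CST : C (S \o T) by exact: (opalgM Calg).
pose P := (r^-1)%:C *: (S \o T).
have CP : C P by exact: (opalgZ Calg).
have P1 : opnorm P < 1.
  apply: le_lt_trans (opnormZ_le _ (opalg_bounded Calg CST)) _.
  rewrite modulus_real ger0_norm ?invr_ge0 ?(ltW r0) //.
  rewrite mulrC ltr_pdivrMr // mul1r /r expr2.
  apply: le_lt_trans (opnormM bS bT) _.
  apply: le_lt_trans (_ : q * q < _); first by rewrite ler_wpM2r.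
  by rewrite ltr_pM.
have [Q CQ QE] := neumann_series Calg CP P1.
have piQE : pi Q = pi P + (pi Q \o pi P).
  have CQP : C (Q \o P) by exact: (opalgM Calg).
  by rewrite {1}QE (alg_homD pihom CP CQP) (alg_homM pihom CQ CP).
have piPE v : pi P v = (r^-1)%:C *: pi S (pi T v).
  by rewrite /P (alg_homZ pihom _ CST) (alg_homM pihom CS CT).
have b0 := opnorm_ge0 (bpi Q CQ); set b := opnorm (pi Q) in b0.
(* With w = pi P v, the tolerance a t / 2 gives Re <v, w> = g^2 / a^2 >= (1 - t/2)^2 >= 1 - t, so |v
   - w|^2 <= 2 t. From w = pi Q (v - w) follows (1 - t)^2 <= 2 b^2 t. This choice of [t] makes the
   right side at most 1/4 and t <= 1/8, a contradiction. *)
pose t := (8 * (b ^+ 2 + 1))^-1.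
have t0 : 0 < t by rewrite invr_gt0 mulr_gt0 // ltr_wpDl // sqr_ge0.
have tb : 8 * (b ^+ 2 + 1) * t = 1 by rewrite mulfV // -invr_eq0 gt_eqF.
have [v v1 hv] := opnorm_approx (bpi T CT) (mulr_gt0 a0 (divr_gt0 t0 (ltr0n _ 2))).
set w := pi P v; set g := hnorm (pi T v) in hv.
have ga : g <= a.
  by apply: le_trans (ler_opnorm _ (bpi T CT)) _; rewrite ler_piMr // ltW.
have g0 : 0 <= g by exact: hnorm_ge0.
have wE : w = pi Q (v - w).
  rewrite (linear_funB (bounded_op_linear (bpi Q CQ))) {1}piQE !fctE /=.
  by rewrite addrK.
have wb : hnorm w <= b * hnorm (v - w) by rewrite {1}wE; apply: ler_opnorm; exact: bpi.
have w1 : hnorm w <= 1.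
  rewrite /w piPE hnormZ modulus_real ger0_norm ?invr_ge0 ?(ltW r0) //.
  rewrite mulrC ler_pdivrMr // mul1r /r expr2.
  apply: le_trans (adjoint_le _ (bpi T CT) piTS) _.
  by rewrite ler_wpM2l // ltW.
have vw : complex.Re (hdot v w) = g ^+ 2 / r.
  rewrite /w piPE hdotZr conjC_real_complex -piTS hdotxx -rmorphM /=.
  by rewrite mulrC.
have gr : 1 - t <= g ^+ 2 / r.
  rewrite ler_pdivlMr // /r.
  have : 0 <= (g - a * (1 - t / 2)) * (g + a * (1 - t / 2)).
    have : t <= 1 by have := mulr_ge0 (sqr_ge0 b) (ltW t0); nra.
    by move=> t1; rewrite mulr_ge0 //; move: hv; rewrite -/a; nra.
  have := sqr_ge0 (a * t); nra.
have gw : g ^+ 2 / r <= hnorm w.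
  rewrite -vw; apply: le_trans (ler_modulus_Re _) _.
  apply: le_trans (hdot_cauchy_schwarz _ _) _.
  by rewrite ler_piMl ?hnorm_ge0.
have := hnorm_sqrB v w; rewrite vw; have := hnorm_ge0 (v - w).
set x := hnorm (v - w) in wb *; set k := g ^+ 2 / r in gr gw *.
have := hnorm_ge0 v; have := hnorm_ge0 w.
set y := hnorm v in v1 *; set z := hnorm w in w1 wb gw * => z0 y0 x0 xE.
have x2 : x ^+ 2 <= 2 * t by rewrite xE; nra.
have bx : 1 - t <= b * x by lra.
have t8 : t <= 1 / 8 by have := mulr_ge0 (sqr_ge0 b) (ltW t0); nra.
have : (1 - t) ^+ 2 <= (b * x) ^+ 2 by rewrite ler_sqr ?nnegrE ?mulr_ge0 //; lra.
have : (b * x) ^+ 2 <= b ^+ 2 * (2 * t) by rewrite exprMn ler_wpM2l // sqr_ge0.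
nra.
Qed.

(** * Gram-Schmidt and finite-rank coisometries *)

(** Subspaces as predicates: membership in the span of a family is expressed as membership in every
    subspace containing the family. *)
Definition linear_stable (K : nzRingType) (V : lmodType K) (P : set V) : Prop :=
  P 0 /\ forall c x y, P x -> P y -> P (c *: x + y).

Lemma linear_stable_sum (K : nzRingType) (V : lmodType K) (P : set V) n
    (c : 'I_n -> K) (f : 'I_n -> V) :
  linear_stable P -> (forall i, P (f i)) -> P (\sum_i c i *: f i).
Proof. by move=> [P0 PD] Pf; elim/big_rec: _ => // i x _; exact: PD. Qed.

(* The vectors [e i] that vanish make up for linear dependencies in [v], so that
   the family keeps its length. *)
Lemma gram_schmidt (R : realType) (H : hilbertType R) (v : nat -> H) N :
  exists e : nat -> H,
  [/\ forall i j, (i < N)%N -> (j < N)%N -> i != j -> hdot (e i) (e j) = 0,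
      forall i, (i < N)%N -> e i = 0 \/ hnorm (e i) = 1,
      forall i, (i < N)%N -> v i = \sum_(j < N) hdot (v i) (e j) *: e j &
      forall P : set H, linear_stable P -> (forall i, (i < N)%N -> P (v i)) ->
        forall i, (i < N)%N -> P (e i)].
Proof.
elim: N => [|N [e [eo en ev eP]]]; first by exists (fun=> 0).
pose u := v N - \sum_(j < N) hdot (v N) (e j) *: e j.
pose f := ((hnorm u)^-1)%:C *: u.
have uo i : (i < N)%N -> hdot u (e i) = 0.
  move=> iN; rewrite hdotBl hdot_suml (bigD1 (Ordinal iN)) //= big1 => [|j ji].
    rewrite addr0 hdotZl hdotxx; case: (en _ iN) => [->|->].
      by rewrite hdot0r mul0r subrr.
    by rewrite expr1n mulr1 subrr.
  by rewrite hdotZl eo ?mulr0.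
have fo i : (i < N)%N -> hdot f (e i) = 0 by move=> /uo h; rewrite hdotZl h mulr0.
have ef i : (i < N)%N -> hdot (e i) f = 0.
  by move=> /fo h; rewrite hdotC h conjC0.
have [u0|u0] := eqVneq (hnorm u) 0.
  have f0 : f = 0 by rewrite /f (hnorm_eq0 u0) scaler0.
  exists (fun i => if i == N then 0 else e i); split.
  - move=> i j; rewrite !ltnS; case: (eqVneq i N) => [_ _ _ _|iN]; first by rewrite hdot0l.
    case: (eqVneq j N) => [_ _ _ _|jN]; first by rewrite hdot0r.
    by rewrite (leq_eqVlt i) (leq_eqVlt j) (negPf iN) (negPf jN); exact: eo.
  - move=> i; rewrite ltnS; case: (eqVneq i N) => [_ _|iN]; first by left.
    by rewrite leq_eqVlt (negPf iN); exact: en.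
  - move=> i iN; rewrite big_ord_recr /= eqxx scaler0 addr0.
    under eq_bigr do rewrite (ltn_eqF (ltn_ord _)).
    move: iN; rewrite ltnS leq_eqVlt => /predU1P[->|]; last exact: ev.
    by apply/eqP; rewrite -subr_eq0 -/u (hnorm_eq0 u0).
  - move=> P Plin Pv i; rewrite ltnS; case: (eqVneq i N) => [_ _|iN]; first by case: Plin.
    rewrite leq_eqVlt (negPf iN); apply: eP => // j jN; apply: Pv.
    exact: ltnW.
have fn : hnorm f = 1.
  by rewrite hnormZ modulus_real ger0_norm ?invr_ge0 ?hnorm_ge0 // mulVf.
have vf : hdot (v N) f *: f = u.
  have -> : v N = u + \sum_(j < N) hdot (v N) (e j) *: e j by rewrite subrK.
  rewrite hdotDl hdot_suml big1 => [|j _]; last by rewrite hdotZl ef ?mulr0.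
  rewrite addr0 hdotZr hdotxx conjC_real_complex /f scalerA -!rmorphM /=.
  by rewrite expr2 mulKf // mulfV // scale1r.
exists (fun i => if i == N then f else e i); split.
- move=> i j; rewrite !ltnS; case: (eqVneq i N) => [->|iN].
    case: (eqVneq j N) => [->|jN] //.
    by rewrite (leq_eqVlt j) (negPf jN) /= => _ jN' _; exact: fo.
  case: (eqVneq j N) => [_|jN]; first by rewrite leq_eqVlt (negPf iN) /= => iN' _ _; exact: ef.
  by rewrite (leq_eqVlt i) (leq_eqVlt j) (negPf iN) (negPf jN); exact: eo.
- move=> i; rewrite ltnS; case: (eqVneq i N) => [_ _|iN]; first by right.
  by rewrite leq_eqVlt (negPf iN); exact: en.
- move=> i iN; rewrite big_ord_recr /= eqxx.
  under eq_bigr do rewrite (ltn_eqF (ltn_ord _)).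
  move: iN; rewrite ltnS leq_eqVlt => /predU1P[->|iN].
    by rewrite vf addrC subrK.
  have vif : hdot (v i) f = 0.
    by rewrite ev // hdot_suml big1 // => j _; rewrite hdotZl ef ?mulr0.
  by rewrite vif scale0r addr0; exact: ev.
- move=> P Plin Pv i; have Pe j : (j < N)%N -> P (e j).
    by apply: eP => // k kN; apply: Pv; exact: ltnW.
  rewrite ltnS; case: (eqVneq i N) => [_ _|iN]; last first.
    by rewrite leq_eqVlt (negPf iN); exact: Pe.
  have [P0 PD] := Plin; rewrite /f -[_ *: u]addr0; apply: (PD) => //.
  rewrite /u addrC -scaleN1r; apply: (PD); last exact: Pv.
  exact: (linear_stable_sum _ Plin (fun j => Pe j (ltn_ord j))).
Qed.

Lemma ell2_hdotE (R : realType) n (x y : ell2 R n) :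
  hdot x y = \sum_i x i 0 * conjC (y i 0).
Proof. by []. Qed.

(** [V \o W] is the orthogonal projection onto the span of the [v i]. As some Gram-Schmidt vectors
    may vanish, [V] is only a partial isometry; this lets spans of varying dimension share the same
    C^N. The last clause says that the range of [V] is no larger than the span. *)
Lemma finite_rank_coisometry (R : realType) (H : hilbertType R) (v : nat -> H) N :
  exists (V : ell2 R N -> H) (W : H -> ell2 R N),
  [/\ [/\ linear V, linear W & forall x y, hdot (V x) y = hdot x (W y)],
      forall x, hnorm (V x) <= hnorm x,
      forall y, hnorm (W y) <= hnorm y,
      forall i, (i < N)%N -> V (W (v i)) = v i &
      forall P : set H, linear_stable P -> (forall i, (i < N)%N -> P (v i)) ->
        forall x, P (V x)].
Proof.
have [e [eo en ev eP]] := gram_schmidt v N.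
pose V (x : ell2 R N) : H := \sum_(i < N) x i 0 *: e i.
pose W (y : H) : ell2 R N := \col_i hdot y (e i).
have Vlin : linear V.
  move=> c x y; rewrite /V scaler_sumr -big_split; apply: eq_bigr => i _ /=.
  by rewrite !mxE scalerDl scalerA.
have Wlin : linear W.
  by move=> c x y; apply/colP => i; rewrite !mxE hdotDl hdotZl.
have VW x y : hdot (V x) y = hdot x (W y).
  rewrite hdot_suml ell2_hdotE; apply: eq_bigr => i _.
  by rewrite !mxE hdotZl -hdotC.
have Vle x : hnorm (V x) <= hnorm x.
  rewrite -ler_sqr ?nnegrE ?hnorm_ge0 // -lecR -!hdotxx VW !ell2_hdotE.
  apply: ler_sum => i _; rewrite !mxE hdot_suml (bigD1 i) //= big1 => [|j ji].
    rewrite addr0 hdotZl hdotxx rmorphM /= conjC_real_complex mulrA.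
    rewrite mul_conjC_modulus -rmorphM /= lecR ler_piMr ?sqr_ge0 //.
    by case: (en i (ltn_ord i)) => [->|->]; rewrite ?hnorm0 ?expr0n ?expr1n.
  by rewrite hdotZl eo ?mulr0.
exists V, W; split=> //.
- move=> y; have [h|n0] := eqVneq (hnorm (W y)) 0; first by rewrite h hnorm_ge0.
  have Wy : 0 < hnorm (W y) by rewrite lt_neqAle eq_sym n0 hnorm_ge0.
  rewrite -(ler_pM2l Wy) -expr2; have := hdot_cauchy_schwarz (V (W y)) y.
  rewrite VW hdotxx modulus_real ger0_norm ?sqr_ge0 // => /le_trans; apply.
  by rewrite ler_wpM2r ?hnorm_ge0.
- move=> i iN; rewrite [RHS]ev //; by apply: eq_bigr => j _; rewrite mxE.
- move=> P Plin Pv x; apply: (linear_stable_sum _ Plin) => i.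
  exact: eP.
Qed.

(** * Limits along ultrafilters *)

Section Limits.
Variables (R : realType) (H : hilbertType R) (I : Type) (F : set_system I).
Context {FF : ProperFilter F}.
Implicit Types (f : I -> H) (l : H).

Lemma cvg_hnormP f l : f @ F --> l <-> hnorm (l - f t) @[t --> F] --> (0 : R).
Proof. exact: cvg_Re_normP. Qed.

Lemma cvg_hnorm_le f l (g : I -> R) : (forall t, hnorm (l - f t) <= g t) ->
  g @ F --> (0 : R) -> f @ F --> l.
Proof.
move=> fg g0; apply/cvg_hnormP; apply: (squeeze_cvgr _ (cvg_cst 0) g0).
by apply: nearW => t; rewrite hnorm_ge0 fg.
Qed.

Lemma cvg_hnorm f l : f @ F --> l -> hnorm (f t) @[t --> F] --> hnorm l.
Proof.
move=> /cvg_hnormP fl; have h0 : (fun=> hnorm l) @ F --> hnorm l by exact: cvg_cst.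
apply: (@squeeze_cvgr _ _ _ _ (fun t => hnorm l - hnorm (l - f t))
  (fun t => hnorm l + hnorm (l - f t))).
- apply: nearW => t; rewrite lerBlDr; apply/andP; split.
    by rewrite addrC -[X in hnorm X <= _](subrK (f t)) ler_hnormD.
  by rewrite -[X in hnorm X <= _](subKr l) ler_hnormB.
- by rewrite -[X in _ --> X]subr0; exact: cvgB.
- by rewrite -[X in _ --> X]addr0; exact: cvgD.
Qed.

Lemma cvg_hnorm_ge f l (M : R) : f @ F --> l ->
  (forall t, hnorm (f t) <= M) -> hnorm l <= M.
Proof. by move=> /cvg_hnorm fl fM; apply: (cvgr_to_le fl); exact: nearW. Qed.

Lemma cvg_hilbert_unique f l l' : f @ F --> l -> f @ F --> l' -> l = l'.
Proof. exact: cvg_unique. Qed.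

Lemma cvg_hilbert_sum n (f : 'I_n -> I -> H) (l : 'I_n -> H) :
  (forall i, f i @ F --> l i) -> \sum_i f i t @[t --> F] --> \sum_i l i.
Proof. by move=> fl; apply: cvg_big => //; exact: add_continuous. Qed.

End Limits.

(** The difference of the two sides equals <l - f t, y> - <x, m - g t> for every t, and
    Cauchy-Schwarz sends it to 0. *)
Lemma cvg_hdot_eq (R : realType) (H K : hilbertType R) (I : Type)
    (F : set_system I) {FF : ProperFilter F} (f : I -> H) (g : I -> K) l m x y :
  f @ F --> l -> g @ F --> m -> (forall t, hdot (f t) y = hdot x (g t)) ->
  hdot l y = hdot x m.
Proof.
move=> /cvg_hnormP fl /cvg_hnormP gm fg.
suff m0 : modulus (hdot l y - hdot x m) = 0.
  by apply/eqP; rewrite -subr_eq0 -normr_eq0 modulusE m0.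
apply/eqP; rewrite eq_le modulus_ge0 andbT.
have : (hnorm (l - f t) * hnorm y + hnorm x * hnorm (m - g t))
    @[t --> F] --> (0 * hnorm y + hnorm x * 0 : R).
  by apply: cvgD; apply: cvgM => //; exact: cvg_cst.
rewrite mul0r mulr0 addr0 => /cvgr_to_ge; apply; apply: nearW => t.
have -> : hdot l y - hdot x m = hdot (l - f t) y - hdot x (m - g t).
  by rewrite hdotBl hdotBr fg opprB addrA subrK.
apply: le_trans (lerD (hdot_cauchy_schwarz _ _) (hdot_cauchy_schwarz _ _)).
by rewrite -lecR rmorphD /= -!modulusE ler_normB.
Qed.

(** The image filter lives on a compact segment and so clusters at some p; an ultrafilter missing a
    neighbourhood of p would contain its complement. A single ultrafilter serves all operators and
    vectors at once, where subsequences would call for repeated extraction. *)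
Lemma ultrafilter_bounded_cvg (R : realType) (I : Type) (F : set_system I)
    (f : I -> R) (M : R) : UltraFilter F -> (forall t, `|f t| <= M) ->
  exists l : R, f @ F --> l.
Proof.
move=> FU fM; have [|p [_ clp]] := @segment_compact R (- M) M (f @ F) _.
  by apply: nearW => t /=; rewrite in_itv /= -ler_norml.
exists p => B pB; have [//|FnB] := in_ultra_setVsetC (f @^-1` B) FU.
by have [x [/= nBx Bx]] := clp (~` B) B FnB pB.
Qed.

Lemma ell2_bounded_cvg (R : realType) n (I : Type) (F : set_system I)
    (f : I -> ell2 R n) (M : R) : UltraFilter F ->
  (forall t, hnorm (f t) <= M) -> exists l : ell2 R n, f @ F --> l.
Proof.
move=> FU fM.
have /choice[a ha] i : exists l : R, complex.Re (f t i 0) @[t --> F] --> l.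
  apply: (ultrafilter_bounded_cvg (M := M)) => t.
  exact: le_trans (ler_l2norm_Re (f t) i) (fM t).
have /choice[b hb] i : exists l : R, complex.Im (f t i 0) @[t --> F] --> l.
  apply: (ultrafilter_bounded_cvg (M := M)) => t.
  exact: le_trans (ler_l2norm_Im (f t) i) (fM t).
exists (\col_i (a i +i* b i)); apply: ell2_cvg_coord => i; rewrite mxE.
- exact: ha.
- exact: hb.
Qed.

(** * Limits of compressions *)

Section MatrixNorm.
Variables (R : realType) (H : hilbertType R) (n : nat) (T : 'M[H -> H]_n).

Lemma mxopnorm_le (M : R) :
  (forall x : 'I_n -> H, \sum_j hnorm (x j) ^+ 2 <= 1 ->
    Num.sqrt (\sum_i hnorm (\sum_j T i j (x j)) ^+ 2) <= M) ->
  mxopnorm T <= M.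
Proof.
move=> hM; apply: ge_sup => [|_ [x /= x1 <-]]; last exact: hM.
exists (Num.sqrt (\sum_i hnorm (\sum_j T i j 0) ^+ 2)), (fun=> 0) => //=.
by rewrite big1 // => j _; rewrite hnorm0 expr0n.
Qed.

Lemma ler_mxopnorm (x : 'I_n -> H) : (forall i j, bounded_op (T i j)) ->
  \sum_j hnorm (x j) ^+ 2 <= 1 ->
  Num.sqrt (\sum_i hnorm (\sum_j T i j (x j)) ^+ 2) <= mxopnorm T.
Proof.
move=> bT x1; apply: ub_le_sup; last by exists x.
(* A crude bound, each |y j| being at most 1; it only serves to make the supremum genuine. *)
exists (Num.sqrt (\sum_i (\sum_j opnorm (T i j)) ^+ 2)) => _ [y /= y1 <-].
rewrite ler_wsqrtr // ler_sum // => i _; rewrite ler_sqr ?nnegrE ?hnorm_ge0 //.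
  apply: le_trans (ler_hnorm_sum _) _; apply: ler_sum => j _.
  apply: le_trans (ler_opnorm _ (bT i j)) _; rewrite ler_piMr ?opnorm_ge0 //.
  rewrite -(@ler_pXn2r _ 2) ?nnegrE ?hnorm_ge0 // expr1n.
  apply: le_trans y1; rewrite (bigD1 j) //= lerDl sumr_ge0 // => k _.
  exact: sqr_ge0.
by apply: sumr_ge0 => j _; exact: opnorm_ge0.
Qed.

End MatrixNorm.

Section CompressionLimit.
Variables (R : realType) (H : hilbertType R) (N : nat) (I : Type).
Variables (U : set_system I) (UU : UltraFilter U).
Variables (V : I -> ell2 R N -> H) (W : I -> H -> ell2 R N).
Hypotheses (Vlin : forall t, linear (V t)) (Wlin : forall t, linear (W t)).
Hypothesis VW : forall t x y, hdot (V t x) y = hdot x (W t y).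
Hypotheses (Vle : forall t x, hnorm (V t x) <= hnorm x)
           (Wle : forall t y, hnorm (W t y) <= hnorm y).

Let PU : ProperFilter U. Proof. exact: ultra_proper. Qed.
Local Existing Instance PU.

(** [lim] has a default value where no limit exists; for a bounded [T] the compressions are
    uniformly bounded in C^N and the ultrafilter gives a true limit. *)
Definition compression_limit (T : H -> H) (x : ell2 R N) : ell2 R N :=
  lim (W t (T (V t x)) @[t --> U]).

Let compression_le T t x : bounded_op T ->
  hnorm (W t (T (V t x))) <= opnorm T * hnorm x.
Proof.
move=> bT; apply: le_trans (Wle _ _) _; apply: le_trans (ler_opnorm _ bT) _.
by rewrite ler_wpM2l ?opnorm_ge0.
Qed.

Lemma compression_cvg T x : bounded_op T ->
  W t (T (V t x)) @[t --> U] --> compression_limit T x.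
Proof.
move=> bT; have [l hl] := ell2_bounded_cvg UU (fun t => compression_le t x bT).
by rewrite /compression_limit (cvg_lim _ hl).
Qed.

Lemma compression_limitP T x l : bounded_op T ->
  W t (T (V t x)) @[t --> U] --> l -> compression_limit T x = l.
Proof. by move=> bT; apply: cvg_hilbert_unique; exact: compression_cvg. Qed.

(** The compressions of [T] are equicontinuous with constant |T|, so the argument may move with t.
    Both multiplicativity and the evaluation of words rest on this. *)
Lemma compression_cvg_seq T (f : I -> ell2 R N) x : bounded_op T ->
  f @ U --> x -> W t (T (V t (f t))) @[t --> U] --> compression_limit T x.
Proof.
move=> bT /cvg_hnormP fx; have /cvg_hnormP hT := @compression_cvg T x bT.
apply: (cvg_hnorm_le (g := fun t => hnorm (compression_limit T x - W t (T (V t x)))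
   + opnorm T * hnorm (x - f t))) => [t|].
  rewrite -[X in X - _](subrK (W t (T (V t x)))) -addrA.
  apply: le_trans (ler_hnormD _ _) _; rewrite lerD2l.
  rewrite -(linear_funB (Wlin t)) -(linear_funB (bounded_op_linear bT)).
  by rewrite -(linear_funB (Vlin t)) compression_le.
rewrite -[X in _ --> X]addr0 -[X in _ + X](mulr0 (opnorm T)).
by apply: cvgD => //; apply: cvgM => //; exact: cvg_cst.
Qed.

Lemma compression_limit_le T x : bounded_op T ->
  hnorm (compression_limit T x) <= opnorm T * hnorm x.
Proof.
move=> bT; apply: (cvg_hnorm_ge (@compression_cvg T x bT)) => t.
exact: compression_le.
Qed.

Lemma compression_limit_bounded T : bounded_op T ->
  bounded_op (compression_limit T).
Proof.
move=> bT; apply: (bounded_opP (M := opnorm T)) => [c x y|x]; last first.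
  exact: compression_limit_le.
apply: compression_limitP => //.
under eq_cvg do rewrite Vlin (bounded_op_linear bT) Wlin.
by apply: cvgD; [apply: cvgZr|]; exact: compression_cvg.
Qed.

Lemma compression_limitD T S : bounded_op T -> bounded_op S ->
  compression_limit (T + S) = compression_limit T + compression_limit S.
Proof.
move=> bT bS; apply/funext => x; apply: compression_limitP.
  exact: bounded_opD.
under eq_cvg do rewrite !fctE (linear_funD (Wlin _)).
by apply: cvgD; exact: compression_cvg.
Qed.

Lemma compression_limitZ (c : R[i]) T : bounded_op T ->
  compression_limit (c *: T) = c *: compression_limit T.
Proof.
move=> bT; apply/funext => x; apply: compression_limitP.
  exact: bounded_opZ.
under eq_cvg do rewrite !fctE (linear_funZ (Wlin _)).
by apply: cvgZr; exact: compression_cvg.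
Qed.

(** If the range of [V t] is invariant under the right factor [S], inserting the projection V W
    after [S] changes nothing, and W T S V = (W T V) (W S V). *)
Lemma compression_limitM T S : bounded_op T -> bounded_op S ->
  (forall t x, V t (W t (S (V t x))) = S (V t x)) ->
  compression_limit (T \o S) = compression_limit T \o compression_limit S.
Proof.
move=> bT bS VWS; apply/funext => x; apply: compression_limitP.
  exact: bounded_opM.
under eq_cvg do rewrite /= -VWS.
exact: compression_cvg_seq (compression_cvg bS).
Qed.

(** Adjoints pass through every compression; this handles the letters a^*, under which the range of
    [V t] is in general not invariant. *)
Lemma compression_limit_adjoint T S : bounded_op T -> adjoint T S ->
  adjoint (compression_limit T) (compression_limit S).
Proof.
move=> bT TS x y; have bS := adjoint_bounded bT TS.
apply: (cvg_hdot_eq (@compression_cvg T x bT) (@compression_cvg S y bS)) => t.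
by rewrite -VW -TS hdotC -VW -hdotC.
Qed.

(** [V t] and [W t], applied entrywise, are contractions between the n-fold sums, so the bound holds
    at each t and survives the limit. *)
Lemma compression_limit_mxopnorm n (T : 'M[H -> H]_n) :
  (forall i j, bounded_op (T i j)) ->
  mxopnorm (map_mx compression_limit T) <= mxopnorm T.
Proof.
move=> bT; apply: mxopnorm_le => x x1.
have cvgT : Num.sqrt (\sum_i hnorm (\sum_j W t (T i j (V t (x j)))) ^+ 2)
    @[t --> U] -->
    Num.sqrt (\sum_i hnorm (\sum_j map_mx compression_limit T i j (x j)) ^+ 2).
  apply: continuous_cvg; first exact: sqrt_continuous.
  apply: cvg_big => [|i _]; first exact: add_continuous.
  have h : hnorm (\sum_j W t (T i j (V t (x j)))) @[t --> U] -->
      hnorm (\sum_j map_mx compression_limit T i j (x j)).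
    apply: cvg_hnorm; apply: (cvg_hilbert_sum
      (f := fun j t => W t (T i j (V t (x j))))) => j.
    by rewrite mxE; exact: compression_cvg.
  by rewrite expr2; under eq_cvg do rewrite expr2; exact: cvgM.
apply: (cvgr_to_le cvgT); apply: nearW => t.
apply: le_trans (ler_mxopnorm (T := T) (x := fun j => V t (x j)) bT _).
  rewrite ler_wsqrtr // ler_sum // => i _.
  by rewrite ler_sqr ?nnegrE ?hnorm_ge0 // -(linear_fun_sum (Wlin t)).
apply: le_trans x1; apply: ler_sum => j _.
by rewrite ler_sqr ?nnegrE ?hnorm_ge0.
Qed.

End CompressionLimit.

(** * Spans of words and their closure *)

Section LinSpan.
Variables (K : nzRingType) (V : lmodType K) (E : set V).

Lemma lin_span0 : lin_span E 0.
Proof.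
exists 0, (fun=> 0), (fun=> 0); split; first by case.
by rewrite big_ord0.
Qed.

Lemma lin_spanD x y : lin_span E x -> lin_span E y -> lin_span E (x + y).
Proof.
move=> [n [c [w [Ew ->]]]] [m [d [v [Ev ->]]]].
exists (n + m)%N,
  (fun i => match fintype.split i with inl j => c j | inr j => d j end),
  (fun i => match fintype.split i with inl j => w j | inr j => v j end).
split; first by move=> i; case: (fintype.split i).
rewrite big_split_ord /=; congr (_ + _); apply: eq_bigr => i _.
  by rewrite (fintype.unsplitK (inl i)).
by rewrite (fintype.unsplitK (inr i)).
Qed.

Lemma lin_spanZ c x : lin_span E x -> lin_span E (c *: x).
Proof.
move=> [n [d [w [Ew ->]]]]; exists n, (fun i => c * d i), w; split=> //.
by rewrite scaler_sumr; apply: eq_bigr => i _; rewrite scalerA.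
Qed.

Lemma lin_span_gen x : E x -> lin_span E x.
Proof.
move=> Ex; exists 1, (fun=> 1), (fun=> x); split=> //.
by rewrite big_ord1 scale1r.
Qed.

Lemma lin_span_lincomb n (c : 'I_n -> K) (w : 'I_n -> V) :
  (forall i, lin_span E (w i)) -> lin_span E (\sum_i c i *: w i).
Proof.
move=> Ew; elim/big_rec: _ => [|i x _ Ex]; first exact: lin_span0.
by apply: lin_spanD Ex; exact: lin_spanZ.
Qed.

End LinSpan.

Lemma fct_lincombE (R : realType) (H : hilbertType R) n (c : 'I_n -> R[i])
    (w : 'I_n -> H -> H) x :
  (\sum_i c i *: w i) x = \sum_i c i *: w i x.
Proof. by rewrite fct_sumE. Qed.

Section WordSpan.
Variables (R : realType) (H : hilbertType R) (E : set (H -> H)).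
Hypothesis bE : E `<=` @bounded_op R H.

Lemma word_bounded W : word E W -> bounded_op W.
Proof. by elim=> [T /bE //|T W' /bE bT _]; exact: bounded_opM. Qed.

Lemma word_comp W W' : word E W -> word E W' -> word E (W \o W').
Proof.
move=> EW EW'; elim: EW => [T ET|T W1 ET _ IHW]; first exact: word_mul.
exact: (@word_mul _ _ T (W1 \o W')).
Qed.

Lemma lincomb_bounded n (c : 'I_n -> R[i]) (w : 'I_n -> H -> H) :
  (forall i, bounded_op (w i)) -> bounded_op (\sum_i c i *: w i).
Proof.
move=> bw; elim/big_rec: _ => [|i x _ bx]; last first.
  by apply: bounded_opD bx; exact: bounded_opZ.
apply: (bounded_opP (M := 0)) => [a x y|x].
  by change (0 = a *: (0 : H) + 0 :> H); rewrite scaler0 addr0.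
by change (hnorm (0 : H) <= 0 * hnorm x); rewrite hnorm0 mul0r.
Qed.

Lemma lincomb_comp n (c : 'I_n -> R[i]) (w : 'I_n -> H -> H) (T : H -> H) :
  (\sum_i c i *: w i) \o T = \sum_i c i *: (w i \o T).
Proof. by apply/funext => x; rewrite /= !fct_lincombE. Qed.

Lemma comp_lincomb n (c : 'I_n -> R[i]) (w : 'I_n -> H -> H) (T : H -> H) :
  linear T -> T \o (\sum_i c i *: w i) = \sum_i c i *: (T \o w i).
Proof.
move=> Tlin; apply/funext => x; rewrite /= !fct_lincombE (linear_fun_sum Tlin).
by apply: eq_bigr => i _; rewrite (linear_funZ Tlin).
Qed.

Lemma word_span_bounded : lin_span (word E : set (H -> H)) `<=` @bounded_op R H.
Proof.
move=> _ [n [c [w [Ew ->]]]]; apply: lincomb_bounded => i.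
exact: word_bounded.
Qed.

Lemma word_spanM T S : lin_span (word E : set (H -> H)) T ->
  lin_span (word E : set (H -> H)) S -> lin_span (word E : set (H -> H)) (T \o S).
Proof.
move=> [n [c [w [Ew ->]]]] [m [d [v [Ev ->]]]].
rewrite lincomb_comp; apply: lin_span_lincomb => i.
rewrite comp_lincomb; last exact: bounded_op_linear (word_bounded (Ew i)).
by apply: lin_span_lincomb => j; apply: lin_span_gen; exact: word_comp.
Qed.

Hypothesis adjE : forall T, E T -> exists2 S, E S & adjoint T S.

Lemma word_adjoint W : word E W -> exists2 W', word E W' & adjoint W W'.
Proof.
elim=> [T /adjE[S ES TS]|T W1 /adjE[S ES TS] _ [W' EW' WW']].
  by exists S => //; exact: word_letter.
exists (W' \o S); last exact: adjointM.
by apply: word_comp => //; exact: word_letter.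
Qed.

Lemma word_span_adjoint T : lin_span (word E : set (H -> H)) T ->
  exists2 S, lin_span (word E : set (H -> H)) S & adjoint T S.
Proof.
move=> [n [c [w [Ew ->]]]].
have /choice[v hv] i : exists S, word E S /\ adjoint (w i) S.
  by have [S] := word_adjoint (Ew i); exists S.
exists (\sum_i conjC (c i) *: v i).
  by apply: lin_span_lincomb => i; apply: lin_span_gen; case: (hv i).
move=> x y; rewrite !fct_lincombE hdot_suml hdot_sumr; apply: eq_bigr => i _.
by rewrite hdotZl hdotZr conjCK (hv i).2.
Qed.

End WordSpan.

(* The closure is taken inside [C], which provides the adjoints. *)
Lemma closure_cstar_algebra (R : realType) (H : hilbertType R)
    (C P : set (H -> H)) :
  cstar_algebra C -> P `<=` @bounded_op R H -> P 0 ->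
  (forall T S, P T -> P S -> P (T + S)) ->
  (forall (c : R[i]) T, P T -> P (c *: T)) ->
  (forall T S, P T -> P S -> P (T \o S)) ->
  (forall T, P T -> exists2 S, P S & adjoint T S) ->
  cstar_algebra [set T | C T /\
    forall e : R, 0 < e -> exists2 S, P S & opnorm (T - S) < e].
Proof.
move=> [Calg Cstar] bP P0 PD PZ PM Padj.
have bC T : C T -> bounded_op T by exact: (opalg_bounded Calg).
split; last first.
  move=> T [CT Tcl]; have [S CS TS] := Cstar T CT; exists S => //.
  split=> // e /Tcl[U PU TU]; have [U' PU' UU'] := Padj U PU; exists U' => //.
  apply: le_lt_trans TU; apply: adjoint_opnorm (adjointB TS UU').
  by apply: bounded_opB; [exact: bC|exact: bP].
split.
- by move=> T [/bC].
- split=> [|e e0]; first exact: (opalg0 Calg).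
  exists 0 => //; apply: le_lt_trans e0; apply: opnorm_le => // x.
  by rewrite !fctE subr0 hnorm0 mul0r.
- move=> T S [CT Tcl] [CS Scl]; split=> [|e e0]; first exact: (opalgD Calg).
  have e1 : 0 < e / 2 by rewrite divr_gt0.
  have [T' PT' TT'] := Tcl _ e1; have [S' PS' SS'] := Scl _ e1.
  exists (T' + S'); first exact: PD.
  rewrite opprD addrACA; apply: le_lt_trans (opnormD _ _) _.
  + by apply: bounded_opB; [exact: bC|exact: bP].
  + by apply: bounded_opB; [exact: bC|exact: bP].
  + by lra.
- move=> c T [CT Tcl]; split=> [|e e0]; first exact: (opalgZ Calg).
  have c0 := modulus_ge0 c; have c1 : 0 < modulus c + 1 by rewrite ltr_wpDl.
  have [T' PT' TT'] := Tcl _ (divr_gt0 e0 c1); exists (c *: T'); first exact: PZ.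
  have bTT : bounded_op (T - T') by apply: bounded_opB; [exact: bC|exact: bP].
  rewrite -scalerBr; apply: le_lt_trans (opnormZ_le _ bTT) _.
  move: TT'; rewrite ltr_pdivlMr //; have := opnorm_ge0 bTT; nra.
- move=> T S [CT Tcl] [CS Scl]; split=> [|e e0]; first exact: (opalgM Calg).
  have bT := bC _ CT; have bS := bC _ CS.
  have T0 := opnorm_ge0 bT; have S0 := opnorm_ge0 bS.
  (* Tolerances for T (S - S') + (T - T') S': the minimum with 1 ensures |S'| <= |S| + 1, so that
     each summand has norm below e/2. *)
  have e1 : 0 < Num.min 1 (e / (2 * (opnorm T + 1))).
    by rewrite lt_min ltr01 /= divr_gt0 // mulr_gt0 // ltr_wpDl.
  have e2 : 0 < e / (2 * (opnorm S + 1)).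
    by rewrite divr_gt0 // mulr_gt0 // ltr_wpDl.
  have [S' PS' SS'] := Scl _ e1; have [T' PT' TT'] := Tcl _ e2.
  have bT' := bP _ PT'; have bS' := bP _ PS'.
  have bTT := bounded_opB bT bT'; have bSS := bounded_opB bS bS'.
  have S'le : opnorm S' <= opnorm S + 1.
    have -> : S' = S + (-1 : R[i]) *: (S - S').
      by rewrite scaleN1r opprB addrC subrK.
    apply: le_trans (opnormD bS (bounded_opZ _ bSS)) _; rewrite lerD2l.
    apply: le_trans (opnormZ_le _ bSS) _.
    rewrite /modulus normrN1 mul1r; apply/ltW; move: SS'; rewrite lt_min.
    by case/andP.
  exists (T' \o S'); first exact: PM.
  have -> : (T \o S) - (T' \o S') = (T \o (S - S')) + ((T - T') \o S').
    apply/funext => x; rewrite !fctE /= (linear_funB (bounded_op_linear bT)).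
    by rewrite addrA subrK.
  apply: le_lt_trans (opnormD (bounded_opM bT bSS) (bounded_opM bTT bS')) _.
  have := opnormM bT bSS; have := opnormM bTT bS'.
  move: SS'; rewrite lt_min => /andP[_]; rewrite ltr_pdivlMr ?mulr_gt0 ?ltr_wpDl //.
  move: TT'; rewrite ltr_pdivlMr ?mulr_gt0 ?ltr_wpDl //.
  have := opnorm_ge0 bTT; have := opnorm_ge0 bSS; have := opnorm_ge0 bS'.
  set a := opnorm T in T0 *; set b := opnorm S in S0 S'le *.
  set x := opnorm (T - T'); set y := opnorm (S - S').
  set b' := opnorm S' in S'le * => b'0 y0 x0 h1 h2 h3 h4.
  have h5 : x * b' <= x * (b + 1) by rewrite ler_wpM2l.
  lra.
- move=> T bT Tcl; split=> [|e e0].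
    apply: (opalg_closed Calg bT) => e /Tcl[S [CS _] TS].
    by exists S.
  have e1 : 0 < e / 2 by rewrite divr_gt0.
  have [S [CS /(_ _ e1)[S' PS' SS']] TS] := Tcl _ e1; exists S' => //.
  have -> : T - S' = (T - S) + (S - S') by rewrite addrA subrK.
  apply: le_lt_trans (opnormD _ _) _; last by lra.
  + by apply: bounded_opB => //; exact: bC.
  + by apply: bounded_opB; [exact: bC|exact: bP].
Qed.

(** * The maximal C*-cover of a finite-dimensional operator algebra *)

(* [L] lists the proper suffixes of the word, the empty one being [id]: these are
   the operators whose values a letter of the word gets applied to. *)
Inductive word_suffixes (X : Type) (E : set (X -> X)) :
    (X -> X) -> seq (X -> X) -> Prop :=
| word_suffixes_letter T : E T -> word_suffixes E T [:: id]
| word_suffixes_mul T W L : E T -> word_suffixes E W L ->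
    word_suffixes E (T \o W) (W :: L).

Lemma word_suffixes_exists (X : Type) (E : set (X -> X)) W :
  word E W -> exists L, word_suffixes E W L.
Proof.
elim=> [T ET|T W' ET _ [L EL]]; first by exists [:: id]; exact: word_suffixes_letter.
by exists (W' :: L); exact: word_suffixes_mul.
Qed.

Lemma word_suffixes_word (X : Type) (E : set (X -> X)) W L :
  word_suffixes E W L -> word E W.
Proof.
by elim=> [T ET|T W' L' ET _ EW]; [exact: word_letter|exact: word_mul].
Qed.

Section AlgHom.
Variables (R : realType) (H L : hilbertType R) (C : set (H -> H)).
Variable pi : (H -> H) -> (L -> L).
Hypotheses (Calg : operator_algebra C) (pihom : alg_hom C pi).

Lemma alg_hom0 : pi 0 = 0.
Proof.
by have := alg_homZ pihom 0 (opalg0 Calg); rewrite !scale0r.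
Qed.

Lemma alg_homB T S : C T -> C S -> pi (T - S) = pi T - pi S.
Proof.
move=> CT CS; have CNS : C (-1 *: S) by exact: (opalgZ Calg).
rewrite -scaleN1r (alg_homD pihom CT CNS) (alg_homZ pihom _ CS).
by rewrite scaleN1r.
Qed.

Lemma opalgB T S : C T -> C S -> C (T - S).
Proof.
move=> CT CS; rewrite -scaleN1r; apply: (opalgD Calg) => //.
exact: (opalgZ Calg).
Qed.

Lemma opalg_lincomb n (c : 'I_n -> R[i]) (w : 'I_n -> H -> H) :
  (forall i, C (w i)) -> C (\sum_i c i *: w i).
Proof.
move=> Cw; elim/big_rec: _ => [|i x _ Cx]; first exact: (opalg0 Calg).
by apply: (opalgD Calg) => //; exact: (opalgZ Calg).
Qed.

Lemma alg_hom_lincomb n (c : 'I_n -> R[i]) (w : 'I_n -> H -> H) :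
  (forall i, C (w i)) -> pi (\sum_i c i *: w i) = \sum_i c i *: pi (w i).
Proof.
move=> Cw; elim: n c w Cw => [|n IHn] c w Cw; first by rewrite !big_ord0 alg_hom0.
rewrite !big_ord_recl (alg_homD pihom) ?(alg_homZ pihom) ?IHn //.
  exact: (opalgZ Calg).
exact: opalg_lincomb.
Qed.

End AlgHom.

(** Multiplicativity of [Phi] is asked only on pairs from mu(A), where invariance of the subspaces
    provides it. *)
Lemma alg_hom_comp (R : realType) (H K L : hilbertType R) (A : set (H -> H))
    (mu : (H -> H) -> (K -> K)) (Phi : (K -> K) -> (L -> L)) :
  operator_algebra A -> alg_hom A mu ->
  (forall T, bounded_op T -> bounded_op (Phi T)) ->
  (forall T S, bounded_op T -> bounded_op S -> Phi (T + S) = Phi T + Phi S) ->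
  (forall (c : R[i]) T, bounded_op T -> Phi (c *: T) = c *: Phi T) ->
  (forall T S, A T -> A S -> Phi (mu T \o mu S) = Phi (mu T) \o Phi (mu S)) ->
  alg_hom A (Phi \o mu).
Proof.
move=> Aalg muhom Phib PhiD PhiZ PhiM.
have bmu T : A T -> bounded_op (mu T) by exact: (alg_hom_bounded muhom).
split=> [T AT|T S AT AS|c T AT|T S AT AS] /=.
- exact/Phib/bmu.
- by rewrite (alg_homD muhom AT AS) PhiD //; exact: bmu.
- by rewrite (alg_homZ muhom _ AT) PhiZ //; exact: bmu.
- by rewrite (alg_homM muhom AT AS) PhiM.
Qed.

Section MaxCover.
Variables (R : realType) (H K : hilbertType R) (A : set (H -> H)).
Variables (C : set (K -> K)) (mu : (H -> H) -> (K -> K)).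
Hypotheses (Aalg : operator_algebra A) (hmax : max_cstar_cover A C mu).

Let E : set (K -> K) := mu @` A `|` adjoints (mu @` A).
Let Cstar : cstar_algebra C. Proof. exact: max_cover_cstar hmax. Qed.
Let Calg : operator_algebra C. Proof. by case: Cstar. Qed.
Let muhom : alg_hom A mu. Proof. exact: max_cover_hom hmax. Qed.
Let bC : C `<=` @bounded_op R K. Proof. exact: opalg_bounded Calg. Qed.

Lemma max_cover_letter_in : E `<=` C.
Proof.
have muC T : A T -> C (mu T).
  by move=> AT; rewrite -(max_cover_generated hmax) => B [_]; apply; exists T.
move=> T [[S AS <-]|[_ [S AS <-] ST]]; first exact: muC.
have [T' CT' ST'] := Cstar.2 _ (muC _ AS).
by rewrite (adjoint_unique ST ST').
Qed.

Lemma max_cover_letter_adjoint T : E T -> exists2 S, E S & adjoint T S.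
Proof.
move=> ET; have [[S AS ST]|[_ [S AS <-] ST]] := ET.
  have [T' _ TT'] := Cstar.2 _ (max_cover_letter_in ET).
  by exists T' => //; right; exists T => //; exists S.
by exists (mu S); [left; exists S|exact: adjoint_sym].
Qed.

Lemma max_cover_word_in W : word E W -> C W.
Proof.
elim=> [T /max_cover_letter_in //|T W' /max_cover_letter_in CT _ CW].
exact: (opalgM Calg).
Qed.

Lemma star_polynomials_in s : star_polynomials A mu s -> C s.
Proof.
move=> [n [c [w [Ew ->]]]]; apply: (opalg_lincomb Calg) => i.
exact: max_cover_word_in.
Qed.

(** The closure of the *-polynomials within [C] is a C*-algebra containing mu(A), and [C] is the
    smallest such. *)
Lemma star_polynomials_dense T (e : R) : C T -> 0 < e ->
  exists2 s, star_polynomials A mu s & opnorm (T - s) < e.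
Proof.
pose D := [set T | C T /\ forall e : R, 0 < e ->
   exists2 s, star_polynomials A mu s & opnorm (T - s) < e].
have Dalg : cstar_algebra D.
  have bE : E `<=` @bounded_op R K by move=> S /max_cover_letter_in /bC.
  apply: closure_cstar_algebra => //.
  - exact: word_span_bounded.
  - exact: lin_span0.
  - by move=> S S'; exact: lin_spanD.
  - by move=> c S; exact: lin_spanZ.
  - by move=> S S'; exact: word_spanM.
  - by move=> S; apply: word_span_adjoint; exact: max_cover_letter_adjoint.
have muD : mu @` A `<=` D.
  move=> _ [S AS <-]; have ES : E (mu S) by left; exists S.
  split=> [|d d0]; first exact: max_cover_letter_in.
  exists (mu S); first by apply: lin_span_gen; exact: word_letter.
  rewrite subrr; apply: le_lt_trans d0; apply: opnorm_le => // x.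
  by rewrite mul0r -[X in _ <= X](@hnorm0 R K).
move=> CT e0; have : D T by move: CT; rewrite -(max_cover_generated hmax); apply.
by move=> [_ /(_ _ e0)].
Qed.

Hypothesis finA : findim A.

Lemma star_polynomial_norm_attained s : star_polynomials A mu s ->
  exists (N : nat) (pi : (K -> K) -> (ell2 R N.+1 -> ell2 R N.+1)),
    star_hom C pi /\ opnorm (pi s) = opnorm s.
Proof.
move=> [n [c [w [Ew sE]]]].
have /choice[Ls hLs] i := word_suffixes_exists (Ew i).
have Cw i : C (w i) by exact: max_cover_word_in.
have Cs : C s by rewrite sE; exact: (opalg_lincomb Calg).
have bs := bC Cs.
have [d [b [Ab bA]]] := finA.
(* [s] joins the proper suffixes so that s xi also lies in the subspace and keeps its norm under
   [W t]. *)
pose L := s :: flatten [seq Ls i | i <- enum 'I_n].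
pose G := L ++ [seq mu (b k) \o l | k <- enum 'I_d, l <- L].
pose N := size G.
have e0 (t : nat) : 0 < t.+1%:R^-1 :> R by rewrite invr_gt0.
have /choice[xi hxi] t : exists x, hnorm x <= 1 /\
    opnorm s - t.+1%:R^-1 < hnorm (s x).
  by have [x] := opnorm_approx bs (e0 t); exists x.
(* Dimension [N.+1] rather than [N], because RFD asks for matrices of positive size; the extra index
   reads the default operator 0. *)
have hVW t := finite_rank_coisometry (fun i => nth 0 G i (xi t)) N.+1.
have [V hV] := choice hVW; have [W hW] := choice hV; clear hVW hV.
have Vlin t : linear (V t) by have [[]] := hW t.
have Wlin t : linear (W t) by have [[]] := hW t.
have VW t x y : hdot (V t x) y = hdot x (W t y) by have [[]] := hW t.
have Vle t x : hnorm (V t x) <= hnorm x by have [] := hW t.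
have Wle t x : hnorm (W t x) <= hnorm x by have [] := hW t.
have GVW t g : g \in G -> V t (W t (g (xi t))) = g (xi t).
  move=> gG; have [_ _ _ fixG _] := hW t.
  have /fixG : (index g G < N.+1)%N by rewrite ltnS ltnW // index_mem.
  by rewrite nth_index.
have VP t (P : set K) : linear_stable P -> (forall g, g \in G -> P (g (xi t))) ->
    forall x, P (V t x).
  move=> Plin PG; have [_ _ _ _] := hW t; apply=> // i _.
  have [iN|iN] := ltnP i N; first by apply: PG; exact: mem_nth.
  by rewrite nth_default //; exact: Plin.1.
pose fixed t : set K := [set y | V t (W t y) = y].
have fixed_lin t : linear_stable (fixed t).
  split=> [|a x y /= hx hy].
    by rewrite /fixed /= (linear_fun0 (Wlin t)) (linear_fun0 (Vlin t)).
  by rewrite /fixed /= Wlin Vlin hx hy.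
have bmu T : A T -> bounded_op (mu T) by exact: (alg_hom_bounded muhom).
have LG l : l \in L -> l \in G by move=> lL; rewrite mem_cat lL.
have fixedL t T l : A T -> l \in L -> fixed t (mu T (l (xi t))).
  move=> AT lL; have [a ->] := bA T AT.
  rewrite (alg_hom_lincomb Aalg muhom a Ab) fct_lincombE.
  apply: linear_stable_sum (fixed_lin t) _ => k.
  apply: (GVW t (mu (b k) \o l)); rewrite mem_cat; apply/orP; right.
  by apply: allpairs_f => //; rewrite mem_enum.
(* It suffices to test the spanning vectors: mu(T) mu(b k) l = mu(T b k) l, and T b k again lies in
   [A]. *)
have inv t T x : A T -> V t (W t (mu T (V t x))) = mu T (V t x).
  move=> AT; apply: (VP t [set y | fixed t (mu T y)]).
    have Tlin := bounded_op_linear (bmu T AT); have [f0 fD] := fixed_lin t.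
    split=> [|a y z fy fz] /=; first by rewrite (linear_fun0 Tlin).
    by rewrite Tlin; exact: fD.
  move=> g; rewrite mem_cat => /orP[gL|/allpairsP[[k l] /= [_ lL ->]]] /=.
    exact: fixedL.
  rewrite -[mu T _]/((mu T \o mu (b k)) (l (xi t))) -(alg_homM muhom) //.
  by apply: fixedL => //; exact: (opalgM Aalg).
(* [U] refines the filter of tails, so ordinary limits such as 1/(t+1) -> 0 remain limits along
   [U]. *)
have [U [UU ooU]] := ultraFilterLemma eventually_filter.
pose Phi := compression_limit U V W.
have phihom : alg_hom A (Phi \o mu).
  apply: alg_hom_comp => //.
  - by move=> T; exact: compression_limit_bounded.
  - by move=> T S; exact: compression_limitD.
  - by move=> a T; exact: compression_limitZ.
  - move=> T S AT AS; apply: compression_limitM => //; [exact: bmu|exact: bmu|].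
    by move=> t x; exact: inv.
have phicc : completely_contractive A (Phi \o mu).
  move=> m T AT; rewrite -(max_cover_isometric hmax AT) map_mx_comp.
  by apply: compression_limit_mxopnorm => // i j; rewrite mxE; exact: bmu.
have [pi [pihom pistar] piE] := max_cover_universal hmax phihom phicc.
exists N, pi; split=> //.
(* For a letter a^*, both [pi] and [Phi] give the adjoint of phi(a), and adjoints are unique. *)
have piPhi T : E T -> pi T = Phi T.
  move=> [[S AS <-]|ET]; first exact: piE.
  have CT : C T by apply: max_cover_letter_in; right.
  have [_ [S AS <-] ST] := ET.
  have CS : C (mu S) by apply: max_cover_letter_in; left; exists S.
  apply: adjoint_unique (pistar _ _ CS CT ST) _.
  by rewrite piE //; apply: compression_limit_adjoint => //; exact: bmu.
have Wxi t : hnorm (W t (xi t)) <= 1 by apply: le_trans (Wle _ _) (hxi t).1.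
have [eta heta] := ell2_bounded_cvg UU Wxi.
have PU : ProperFilter U by exact: ultra_proper.
(* Each proper suffix vector is fixed by V W, so the next letter acts through its compression on
   coordinates that converge by induction. *)
have word_cvg S L' : word_suffixes E S L' -> {subset L' <= L} ->
    W t (S (xi t)) @[t --> U] --> pi S eta.
  elim=> [T ET|T S' L1 ET hS' IH] sub.
    have bT : bounded_op T by exact/bC/max_cover_letter_in.
    have xiVW t : xi t = V t (W t (xi t)).
      by rewrite [RHS](GVW t id) //; apply/LG/sub; rewrite mem_head.
    rewrite (piPhi _ ET); under eq_cvg do rewrite xiVW.
    exact: compression_cvg_seq.
  have CT := max_cover_letter_in ET.
  have CS' := max_cover_word_in (word_suffixes_word hS').
  have SVW t : S' (xi t) = V t (W t (S' (xi t))).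
    by rewrite GVW //; apply/LG/sub; rewrite mem_head.
  rewrite (alg_homM pihom CT CS') (piPhi _ ET) /=.
  under eq_cvg do rewrite /= SVW.
  apply: compression_cvg_seq => //; first exact: bC.
  by apply: IH => l lL1; apply: sub; rewrite inE lL1 orbT.
have s_cvg : W t (s (xi t)) @[t --> U] --> pi s eta.
  rewrite sE (alg_hom_lincomb Calg pihom c Cw) fct_lincombE.
  under eq_cvg do rewrite fct_lincombE (linear_fun_sum (Wlin _)).
  apply: (cvg_hilbert_sum (f := fun i t => W t (c i *: w i (xi t)))) => i.
  under eq_cvg do rewrite (linear_funZ (Wlin _)).
  apply: cvgZr; apply: word_cvg (hLs i) _ => l lLs; rewrite inE; apply/orP; right.
  by apply/flattenP; exists (Ls i) => //; apply: map_f; rewrite mem_enum.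
apply/eqP; rewrite eq_le; apply/andP; split.
  exact: (star_hom_contractive Cstar (conj pihom pistar)).
have eta1 : hnorm eta <= 1 by exact: cvg_hnorm_ge heta Wxi.
apply: le_trans (_ : hnorm (pi s eta) <= _); last first.
  have bpis := alg_hom_bounded pihom Cs.
  by apply: le_trans (ler_opnorm eta bpis) _; rewrite ler_piMr ?opnorm_ge0.
have low : (opnorm s - t.+1%:R^-1) @[t --> U] --> opnorm s.
  rewrite -[X in _ --> X]subr0; apply: cvgB; first exact: cvg_cst.
  by move=> B /(@cvg_harmonic R); exact: ooU.
apply: (ler_cvg_to low (cvg_hnorm s_cvg)); apply: nearW => t.
apply/ltW/(lt_le_trans (hxi t).2).
(* s xi = V W s xi and [V t] is contractive, so |W s xi| is at least |s xi|. *)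
by rewrite -{1}(GVW t s) ?Vle // LG // mem_head.
Qed.

End MaxCover.

(** * Operators on C^n as matrices, and residual finite-dimensionality *)

Section OperatorMatrix.
Variables (R : realType) (n : nat).
Implicit Types T S : ell2 R n -> ell2 R n.

Definition operator_mx T : 'M[R[i]]_n :=
  \matrix_(i, j) T (delta_mx j 0 : 'cV[R[i]]_n) i 0.

Lemma ell2_basisE (x : ell2 R n) :
  x = \sum_i x i 0 *: (delta_mx i 0 : 'cV[R[i]]_n) :> ell2 R n.
Proof.
apply/colP => i; rewrite summxE (bigD1 i) //= big1 => [|j ji].
  by rewrite !mxE !eqxx mulr1 addr0.
by rewrite !mxE eq_sym (negPf ji) mulr0.
Qed.

Lemma ell2_findim : findim [set: ell2 R n].
Proof.
exists n, (fun i => delta_mx i 0 : 'cV[R[i]]_n); split=> // x _.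
by exists (fun i => x i 0); exact: ell2_basisE.
Qed.

Lemma operator_mxE T x : linear T -> operator_mx T *m x = T x.
Proof.
move=> Tlin; rewrite [in RHS](ell2_basisE x) (linear_fun_sum Tlin).
apply/colP => i; rewrite mxE summxE; apply: eq_bigr => j _.
by rewrite (linear_funZ Tlin) !mxE mulrC.
Qed.

Lemma operator_mx_inj T S : linear T -> linear S ->
  operator_mx T = operator_mx S -> T = S.
Proof.
move=> Tlin Slin TS; apply/funext => x.
by rewrite -(operator_mxE x Tlin) TS operator_mxE.
Qed.

Lemma l2opnorm_operator_mx T : linear T -> l2opnorm (operator_mx T) = opnorm T.
Proof.
move=> Tlin; rewrite /l2opnorm /opnorm; congr (sup _).
by apply/seteqP; split=> [_ [x x1 <-]|_ [x x1 <-]]; exists x;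
  rewrite // operator_mxE.
Qed.

End OperatorMatrix.

Lemma operator_mx_star_hom (R : realType) (H : hilbertType R) (C : set (H -> H)) n
    (pi : (H -> H) -> (ell2 R n -> ell2 R n)) :
  star_hom C pi -> mx_star_hom C (fun T => operator_mx (pi T)).
Proof.
move=> [pihom pistar]; split=> [T S CT CS|c T CT|T S CT CS|T S CT CS TS].
- by rewrite (alg_homD pihom CT CS); apply/matrixP => i j; rewrite !mxE.
- by rewrite (alg_homZ pihom c CT); apply/matrixP => i j; rewrite !mxE.
- rewrite (alg_homM pihom CT CS); apply/matrixP => i j; rewrite mxE.
  have [Tlin _] := alg_hom_bounded pihom CT.
  rewrite /= -(operator_mxE _ Tlin) mxE [RHS]mxE; apply: eq_bigr => k _.
  by rewrite !mxE.
- have piTS := pistar T S CT CS TS; apply/matrixP => i j; rewrite !mxE.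
  have dotr (x : ell2 R n) k : hdot x (delta_mx k 0 : 'cV[R[i]]_n) = x k 0.
    rewrite ell2_hdotE (bigD1 k) //= big1 => [|l lk].
      by rewrite mxE !eqxx rmorph1 mulr1 addr0.
    by rewrite mxE (negPf lk) rmorph0 mulr0.
  by rewrite -[LHS]dotr hdotC -piTS dotr.
Qed.

Theorem theorem5p1 (R : realType) (H : hilbertType R) (A : set (H -> H))
    (hA : operator_algebra A) (finA : findim A)
    (K : hilbertType R) (Cmax : set (K -> K)) (mu : (H -> H) -> (K -> K))
    (hmax : max_cstar_cover A Cmax mu) :
  (forall s : K -> K, star_polynomials A mu s ->
     exists F : hilbertType R, findim [set: F] /\
       exists pi : (K -> K) -> (F -> F),
         star_hom Cmax pi /\ opnorm (pi s) = opnorm s) /\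
  RFD Cmax.
Proof.
have attained := star_polynomial_norm_attained hA hmax finA.
have Cstar := max_cover_cstar hmax; have [Calg _] := Cstar.
split=> [s /attained[N [pi [pihom pis]]]|].
  by exists (ell2 R N.+1); split; [exact: ell2_findim|exists pi].
(* The product runs over all *-homomorphisms into some B(C^(N+1)); contractivity makes the resulting
   families bounded. *)
exists {N : nat & {rho : (K -> K) -> (ell2 R N.+1 -> ell2 R N.+1) |
  star_hom Cmax rho}}.
exists (fun i => (projT1 i).+1).
exists (fun i T => operator_mx (sval (projT2 i) T)); split=> //.
- by move=> [N [pi pihom]]; exact: operator_mx_star_hom.
- move=> T CT; exists (opnorm T) => _ [[N [pi pihom]] _ <-] /=.
  have [Tlin _] := alg_hom_bounded pihom.1 CT.
  by rewrite l2opnorm_operator_mx //; exact: (star_hom_contractive Cstar).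
move=> T S CT CS TS; have CTS := opalgB Calg CT CS.
have bC U : Cmax U -> bounded_op U by exact: (opalg_bounded Calg).
have piTS N (pi : (K -> K) -> (ell2 R N.+1 -> ell2 R N.+1)) :
    star_hom Cmax pi -> pi (T - S) = 0.
  move=> pihom; rewrite (alg_homB Calg pihom.1 CT CS).
  have := TS (existT _ N (exist _ pi pihom)) => /=.
  move=> /operator_mx_inj ->; first by rewrite subrr.
  - by have [] := alg_hom_bounded pihom.1 CT.
  - by have [] := alg_hom_bounded pihom.1 CS.
apply/eqP; rewrite -subr_eq0; apply/eqP/(opnorm0_eq0 (bC _ CTS))/eqP.
rewrite eq_le opnorm_ge0 ?andbT; last exact: bC.
rewrite leNgt; apply/negP => d0.
(* Let d = |T - S|. Any [pi] of the family kills T - S, so the one attaining |s| gives |s| <= |T - S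
   - s| < d/3, whence d < 2d/3. *)
have [s Ps sd] := star_polynomials_dense hmax CTS (divr_gt0 d0 (ltr0n _ 3)).
have Cs := star_polynomials_in hmax Ps.
have CTSs := opalgB Calg CTS Cs.
have [N [pi [pihom pis]]] := attained s Ps.
have : opnorm (pi s) <= opnorm (T - S - s).
  apply: le_trans (star_hom_contractive Cstar pihom CTSs).
  rewrite (alg_homB Calg pihom.1 CTS Cs) piTS // sub0r -scaleN1r.
  set U := pi s; have bU : bounded_op U by exact: (alg_hom_bounded pihom.1).
  rewrite -[U in X in X <= _](_ : -1 *: (-1 *: U) = U); last first.
    by rewrite scalerA mulrNN mulr1 scale1r.
  apply: le_trans (opnormZ_le _ (bounded_opZ _ bU)) _.
  by rewrite /modulus normrN1 mul1r.
rewrite pis.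
have := opnormD (bC _ CTSs) (bC _ Cs); rewrite subrK.
lra.
Qed.
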